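(* Assume that all $Q_t^i$ ($0\le t\le T$) and $R_t^i$ ($0\le t\le T-1$), $1\le i\le N$, are symmetric positive definite; that $\mathbb{E}[x_0x_0^\top]$ and $W$ are positive definite; and that the coupled Nash equations given in the context have a unique solution $\mathbf{K}^*=(\mathbf{K}^{1*},\dots,\mathbf{K}^{N*})$. Let $\mathbf{K}^{(0)}$ be an initial policy and assume that the system parameters satisfy $$\frac{(\underline{\sigma}_{\mathbf X})^5}{\|\Sigma_{\mathbf{K}^{*}}\| } >20(N-1)^2\,T^2\,d\, \frac{(\gamma_B)^4(\max_i\{C^i(\mathbf{K}^* )\}+\psi)^4}{\underline{\sigma}_{\mathbf Q}^2\,\underline{\sigma}_{\mathbf R}^2}\left(\frac{\bar{\rho}^{2T}-1}{\bar{\rho}^2-1}\right)^2,$$ so that $$\widehat{\alpha} := \frac{\underline{\sigma}_{\mathbf X}\,\underline{\sigma}_{\mathbf R}}{\|\Sigma_{\mathbf{K}^{*}}\|}-20\,(N-1)^2\,T^2\,d\, \frac{(\gamma_B)^4(\max_i\{C^i(\mathbf{K}^* )\}+\psi)^4}{\underline{\sigma}_{\mathbf X}^4\,\underline{\sigma}_{\mathbf Q}^2\,\underline{\sigma}_{\mathbf R}}\left(\frac{\bar{\rho}^{2T}-1}{\bar{\rho}^2-1}\right)^2 >0 .$$ Then there exists $\eta_0>0$ with $\eta_0\in\mathcal{H}\Big(\frac{1}{\sum_{i=1}^NC^i(\mathbf{K}^{i,(0)},\mathbf{K}^{-i*})+1}\Big)$ such that for every $\epsilon>0$ and every $0<\eta<\eta_0$,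 the iterates of the natural policy gradient method $$K_{t}^{i,(m)} = K_t^{i,(m-1)} - \eta\,\nabla_{K_t^i}C^i(\mathbf{K}^{(m-1)})\,(\Sigma_t^{\mathbf{K}^{(m-1)}})^{-1},\qquad 0\le t\le T-1,\ 1\le i\le N,\ m\ge 1,$$ satisfy $$\sum_{i=1}^N\Big( C^i(\mathbf{K}^{i,(M)},\mathbf{K}^{-i*})-C^i(\mathbf{K}^{*}) \Big)\leq\epsilon$$ whenever $M\geq \frac{1}{\widehat{\alpha}\eta}\log\left(\frac{\sum_{i=1}^N(C^i(\mathbf{K}^{i,(0)},\mathbf{K}^{-i*})-C^{i}(\mathbf{K}^* ))}{\epsilon}\right)$.
   Context: Game: there are $N$ players, horizon $T\ge1$, state dimension $d$, control dimensions $k_1,\dots,k_N$, and matrices $A_t\in\mathbb{R}^{d\times d}$, $B_t^i\in\mathbb{R}^{d\times k_i}$, $R_t^i\in\mathbb{R}^{k_i\times k_i}$ ($0\le t\le T-1$), $Q_t^i\in\mathbb{R}^{d\times d}$ ($0\le t\le T$). The state is $x_{t+1}=A_tx_t+\sum_{i=1}^NB_t^iu_t^i+w_t$, where $x_0$ is Gaussian in $\mathbb{R}^d$ and $w_0,\dots,w_{T-1}$ are zero-mean IID Gaussian, independent of $x_0$, with $W=\mathbb{E}[w_tw_t^\top]$. A policy is $\mathbf{K}=(\mathbf{K}^1,\dots,\mathbf{K}^N)$ with $\mathbf{K}^i=(K_0^i,\dots,K_{T-1}^i)$, $K_t^i\in\mathbb{R}^{k_i\times d}$; players use $u_t^i=-K_t^ix_t$,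 and $x_t=x_t^{\mathbf K}$ is the resulting state process. Player $i$'s cost is $$C^i(\mathbf{K})=\mathbb{E}\Big[\sum_{t=0}^{T-1}\big(x_t^\top Q_t^ix_t+(K_t^ix_t)^\top R_t^i(K_t^ix_t)\big)+x_T^\top Q_T^ix_T\Big],$$ and $\nabla_{K_t^i}C^i$ is its gradient with respect to $K_t^i$. Put $\Sigma_t^{\mathbf K}=\mathbb{E}[x_t^{\mathbf K}(x_t^{\mathbf K})^\top]$, $\Sigma_{\mathbf K}=\sum_{t=0}^T\Sigma_t^{\mathbf K}$, $\Sigma_0=\mathbb{E}[x_0x_0^\top]$. Nash equations (unknowns $K_t^{i*}$, $0\le t\le T-1$, $1\le i\le N$): $$K_t^{i*}=\big(R_t^i+(B_t^i)^\top P_{t+1}^{i*}B_t^i\big)^{-1}(B_t^i)^\top P_{t+1}^{i*}\Big(A_t-\sum_{j\ne i}B_t^jK_t^{j*}\Big),$$ $$P_t^{i*}=Q_t^i+(K_t^{i*})^\top R_t^iK_t^{i*}+\Big(A_t-\sum_{j}B_t^jK_t^{j*}\Big)^\top P_{t+1}^{i*}\Big(A_t-\sum_{j}B_t^jK_t^{j*}\Big),\quad P_T^{i*}=Q_T^i.$$ $(\mathbf{K}^i,\mathbf{K}^{-i*})$ denotes the policy in which player $i$ uses $\mathbf{K}^i$ and each other player $j$ uses $\mathbf{K}^{j*}$. $\mathbf K^{(m)}=(\mathbf K^{1,(m)},\dots,\mathbf K^{N,(m)})$ is the $m$-th iterate. Notation: $\|\cdot\|$ is the spectral norm, $\sigma_{\min}$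 the minimal singular value. For a finite family of matrices, $|||\cdot|||$ is the sum of the spectral norms of its members. $\underline{\sigma}_{\mathbf X}=\min\{\sigma_{\min}(\mathbb{E}[x_0x_0^\top]),\sigma_{\min}(W)\}$, $\underline{\sigma}_{\mathbf R}=\min_{i,t}\sigma_{\min}(R_t^i)$, $\underline{\sigma}_{\mathbf Q}=\min_{i,t}\sigma_{\min}(Q_t^i)$, $\gamma_A=\max_t\|A_t\|$, $\gamma_B=\max_{i,t}\|B_t^i\|$, $\gamma_R=\max_{i,t}\|R_t^i\|$. For a fixed small constant $\delta>0$, $$\rho^*=\max\Big\{\max_{0\le t\le T-1}\Big\|A_t-\sum_{i=1}^NB_t^iK_t^{i*}\Big\|,\,1+\delta\Big\},\qquad \psi=\max_i\{C^i(\mathbf{K}^{i,(0)},\mathbf{K}^{-i*})-C^i(\mathbf{K}^* )\},$$ $$\bar\rho=\rho^*+N\gamma_B\sqrt{\frac{T\psi}{\underline{\sigma}_{\mathbf X}\,\underline{\sigma}_{\mathbf R}}}+\frac{1}{20T^2}.$$ $\mathcal{H}(z)$ denotes the set of polynomials in $z$ and the model parameters, where the model parameters are expressed through $\frac{1}{1+\sum_ik_i}$, $\frac{1}{d+1}$, $d$, $\frac{1}{N+1}$, $\frac{1}{T+1}$, $\frac{1}{\|W\|+1}$, $\frac{1}{\|\Sigma_0\|+1}$, $\frac{1}{\gamma_A+1}$, $\frac{1}{\gamma_B+1}$, $\frac{1}{\gamma_R+1}$, $\frac{1}{\underline{\sigma}_{\mathbf X}+1}$, $\underline{\sigma}_{\mathbf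 X}$, $\frac{1}{\underline{\sigma}_{\mathbf R}+1}$, $\underline{\sigma}_{\mathbf R}$, $\frac{1}{\underline{\sigma}_{\mathbf Q}+1}$, $\underline{\sigma}_{\mathbf Q}$, $\frac{1}{|||\mathbf{K}^*|||+1}$. *)

(* Defs.v *)
From HB Require Import structures.
From mathcomp Require Import all_boot all_order all_algebra.
From mathcomp Require mpoly.
From mathcomp Require Import all_classical all_reals all_analysis.

Set Implicit Arguments.
Unset Strict Implicit.
Unset Printing Implicit Defensive.

Import Order.TTheory GRing.Theory Num.Theory.
Import numFieldNormedType.Exports.

Local Open Scope classical_set_scope.
Local Open Scope ring_scope.

Section LinearAlgebra.
Context {R : realType}.

Definition l2norm n (x : 'cV[R]_n) : R := Num.sqrt (\sum_i x i 0 ^+ 2).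

(* The matrix norm of the library is the entrywise maximum, hence this one. *)
Definition spectral_norm m n (A : 'M[R]_(m, n)) : R :=
  sup [set l2norm (A *m x) | x in [set x : 'cV[R]_n | l2norm x <= 1]].

Definition singular_value n (A : 'M[R]_n) (s : R) : Prop :=
  0 <= s /\ eigenvalue (A^T *m A) (s ^+ 2).

Definition sigma_min n (A : 'M[R]_n) : R := inf [set s | singular_value A s].

Definition quad n (A : 'M[R]_n) (x : 'cV[R]_n) : R := (x^T *m A *m x) 0 0.

Definition sym_posdef n (A : 'M[R]_n) : Prop :=
  A^T = A /\ forall x : 'cV[R]_n, x != 0 -> 0 < quad A x.

(* Maximum and minimum of a finite family; only used on nonempty index types,
   where the supremum and the infimum are attained. *)
Definition fmax (I : finType) (f : I -> R) : R := sup (range f).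
Definition fmin (I : finType) (f : I -> R) : R := inf (range f).

End LinearAlgebra.

Section Probability.
Context {R : realType} {disp : measure_display} {Omega : measurableType disp}.
Variable P : probability Omega R.

Definition rvec n (X : {RV P >-> n.-tuple R}) (omega : Omega) : 'cV[R]_n :=
  \col_j tnth (X omega) j.

Definition mean n (X : Omega -> 'cV[R]_n) : 'cV[R]_n :=
  \col_j fine 'E_P[fun omega => X omega j 0].

Definition second_moment n (X : Omega -> 'cV[R]_n) : 'M[R]_n :=
  \matrix_(i, j) fine 'E_P[fun omega => X omega i 0 * X omega j 0].

(* Degenerate (constant) Gaussians are allowed; the library's normal_prob m 0
   is not the Dirac mass at m, so that case is separate. *)
Definition gaussian_law (m s : R) (B : set R) : \bar R :=
  if s == 0 then dirac m B else normal_prob m s B.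

Definition gaussian_vector n (X : {RV P >-> n.-tuple R}) : Prop :=
  forall a : 'cV[R]_n, exists m s : R, forall B : set R, measurable B ->
    P ((fun omega => (a^T *m rvec X omega) 0 0) @^-1` B) = gaussian_law m s B.

(* Sub-families are covered by taking B i = setT for the other indices. *)
Definition mutually_independent (I : finType) n
    (X : I -> {RV P >-> n.-tuple R}) : Prop :=
  forall B : I -> set (n.-tuple R), (forall i, measurable (B i)) ->
    P (\bigcap_(i in [set: I]) (X i @^-1` B i)) =
    (\prod_(i : I) P (X i @^-1` B i))%E.

Definition same_law n (X Y : {RV P >-> n.-tuple R}) : Prop :=
  forall B : set (n.-tuple R), measurable B ->
    distribution P X B = distribution P Y B.

End Probability.

(* Time-indexed data are functions of t : nat. Only their values for
   t < horizon (t <= horizon for gQ) are constrained or used. *)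
Record lq_game (R : realType) := LQGame {
  nplayers : nat;
  horizon : nat;
  sdim : nat;
  cdim : 'I_nplayers -> nat;
  nplayers_gt0 : (0 < nplayers)%N;
  horizon_gt0 : (0 < horizon)%N;
  sdim_gt0 : (0 < sdim)%N;
  cdim_gt0 : forall i, (0 < cdim i)%N;
  gA : nat -> 'M[R]_sdim;
  gB : forall i : 'I_nplayers, nat -> 'M[R]_(sdim, cdim i);
  gR : forall i : 'I_nplayers, nat -> 'M[R]_(cdim i);
  gQ : 'I_nplayers -> nat -> 'M[R]_sdim;
  gdisp : measure_display;
  Omega : measurableType gdisp;
  Pr : probability Omega R;
  x0 : {RV Pr >-> sdim.-tuple R};
  noise : nat -> {RV Pr >-> sdim.-tuple R};
  x0_gaussian : gaussian_vector x0;
  noise_gaussian : forall t, (t < horizon)%N -> gaussian_vector (noise t);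
  noise_mean0 : forall t, (t < horizon)%N -> mean Pr (rvec (noise t)) = 0;
  noise_same_law : forall s t, (s < horizon)%N -> (t < horizon)%N ->
    same_law (noise s) (noise t);
  x0_noise_independent :
    mutually_independent
      (fun o : option 'I_horizon => if o is Some t then noise t else x0)
}.

Arguments gA {R} l t.
Arguments gB {R} l i t.
Arguments gR {R} l i t.
Arguments gQ {R} l i t.

Section Game.
Context {R : realType} (g : lq_game R).

Local Notation N := (nplayers g).
Local Notation T := (horizon g).
Local Notation d := (sdim g).
Local Notation k := (@cdim R g).
Local Notation A := (gA g).
Local Notation B := (gB g).
Local Notation Rm := (gR g).
Local Notation Q := (gQ g).

Definition policy := forall i : 'I_N, nat -> 'M[R]_(k i, d).

Definition closed_loop (K : policy) (t : nat) : 'M[R]_d :=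
  A t - \sum_i B i t *m K i t.

Fixpoint state (K : policy) (t : nat) (omega : Omega g) : 'cV[R]_d :=
  if t is s.+1 then
    let x := state K s omega in
    let u i := - (K i s *m x) in
    A s *m x + \sum_i B i s *m u i + rvec (noise g s) omega
  else rvec (x0 g) omega.

Definition cost (i : 'I_N) (K : policy) : R :=
  fine 'E_(Pr g)[fun omega =>
    \sum_(t < T) (quad (Q i t) (state K t omega)
                  + quad (Rm i t) (K i t *m state K t omega))
    + quad (Q i T) (state K T omega)].

Definition Sigma_t (K : policy) (t : nat) : 'M[R]_d :=
  second_moment (Pr g) (state K t).

Definition Sigma (K : policy) : 'M[R]_d := \sum_(t < T.+1) Sigma_t K t.

Definition Sigma0 : 'M[R]_d := second_moment (Pr g) (rvec (x0 g)).

(* The noise is identically distributed, so time 0 stands for every time. *)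
Definition W : 'M[R]_d := second_moment (Pr g) (rvec (noise g 0)).

Definition set_gain (K : policy) (i : 'I_N) (t : nat) (M : 'M[R]_(k i, d)) :
    policy :=
  @dfwith _ (fun j : 'I_N => nat -> 'M[R]_(k j, d)) K i
    (@dfwith _ (fun _ : nat => 'M[R]_(k i, d)) (K i) t M).

Definition grad (i : 'I_N) (t : nat) (K : policy) : 'M[R]_(k i, d) :=
  \matrix_(a, b) 'D_(delta_mx a b) (fun M => cost i (set_gain K t M)) (K i t).

Definition unilateral (i : 'I_N) (K K' : policy) : policy :=
  @dfwith _ (fun j : 'I_N => nat -> 'M[R]_(k j, d)) K' i (K i).

Definition nash_equations (K : policy) (P : 'I_N -> nat -> 'M[R]_d) : Prop :=
  forall i,
    (forall t, (t < T)%N ->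
       K i t = invmx (Rm i t + (B i t)^T *m P i t.+1 *m B i t)
               *m (B i t)^T *m P i t.+1
               *m (A t - \sum_(j | j != i) B j t *m K j t)
       /\ P i t = Q i t + (K i t)^T *m Rm i t *m K i t
                  + (closed_loop K t)^T *m P i t.+1 *m closed_loop K t)
    /\ P i T = Q i T.

Definition nash_solution (K : policy) : Prop := exists P, nash_equations K P.

Definition unique_nash_solution (K : policy) : Prop :=
  nash_solution K /\
  forall K', nash_solution K' -> forall i t, (t < T)%N -> K' i t = K i t.

Fixpoint npg (eta : R) (K0 : policy) (m : nat) : policy :=
  if m is m'.+1 then
    let K := npg eta K0 m' in
    fun i t => K i t - eta *: (grad i t K *m invmx (Sigma_t K t))
  else K0.

Definition sigma_X : R := Num.min (sigma_min Sigma0) (sigma_min W).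
Definition sigma_R : R := fmin (fun p : 'I_N * 'I_T => sigma_min (Rm p.1 p.2)).
Definition sigma_Q : R :=
  fmin (fun p : 'I_N * 'I_T.+1 => sigma_min (Q p.1 p.2)).
Definition gamma_A : R := fmax (fun t : 'I_T => spectral_norm (A t)).
Definition gamma_B : R :=
  fmax (fun p : 'I_N * 'I_T => spectral_norm (B p.1 p.2)).
Definition gamma_R : R :=
  fmax (fun p : 'I_N * 'I_T => spectral_norm (Rm p.1 p.2)).

Definition triple_norm (K : policy) : R :=
  \sum_(i < N) \sum_(t < T) spectral_norm (K i t).

Definition gap (i : 'I_N) (K Kstar : policy) : R :=
  cost i (unilateral i K Kstar) - cost i Kstar.

Definition max_cost (K : policy) : R := fmax (fun i : 'I_N => cost i K).

Definition psi (K0 Kstar : policy) : R := fmax (fun i : 'I_N => gap i K0 Kstar).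

Definition rho_star (delta : R) (Kstar : policy) : R :=
  Num.max (fmax (fun t : 'I_T => spectral_norm (closed_loop Kstar t)))
          (1 + delta).

Definition rho_bar (delta : R) (K0 Kstar : policy) : R :=
  rho_star delta Kstar
  + N%:R * gamma_B * Num.sqrt (T%:R * psi K0 Kstar / (sigma_X * sigma_R))
  + (20 * T%:R ^+ 2)^-1.

Definition model_params (Kstar : policy) : seq R :=
  [:: (1 + \sum_i (k i)%:R)^-1; (d%:R + 1)^-1; d%:R; (N%:R + 1)^-1;
      (T%:R + 1)^-1; (spectral_norm W + 1)^-1; (spectral_norm Sigma0 + 1)^-1;
      (gamma_A + 1)^-1; (gamma_B + 1)^-1; (gamma_R + 1)^-1;
      (sigma_X + 1)^-1; sigma_X; (sigma_R + 1)^-1; sigma_R;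
      (sigma_Q + 1)^-1; sigma_Q; (triple_norm Kstar + 1)^-1].

(* The value of a member of H(z): a polynomial in z and the 17 parameters. *)
Definition eval_H (h : mpoly.mpoly 18 R) (z : R) (Kstar : policy) : R :=
  mpoly.meval (fun n : 'I_18 => nth 0 (z :: model_params Kstar) n) h.

End Game.

(* Main.v *)
Require Import Defs.
From HB Require Import structures.
From mathcomp Require Import all_boot all_order all_algebra.
From mathcomp Require mpoly.
From mathcomp Require Import all_classical all_reals all_analysis.
From mathcomp Require Import measurable_realfun.
From mathcomp Require Import ring lra.
Set Implicit Arguments.
Unset Strict Implicit.
Unset Printing Implicit Defensive.
Import Order.TTheory GRing.Theory Num.Theory.
Import numFieldNormedType.Exports.
Local Open Scope classical_set_scope.
Local Open Scope ring_scope.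

(** The proof treats every player as the only controller of a linear system
    and bounds what is lost by ignoring that the other players move.

    Fix a player, let the others use gains [K_j], and put [A] minus the sum of
    their [B_j K_j] for the drift.  The player's cost is the cost of a
    single-agent linear-quadratic problem: second moments follow
    [S_(t+1) = F S_t F^T + W] along the closed loop [F], and the cost-to-go
    matrices follow [P_t = Q + K^T R K + F^T P_(t+1) F].  Telescoping
    [trace (P_t S_t)] along the trajectory of another gain [K'] gives the exact
    identity [lqcost_diff]: the cost difference is the sum over time of
    [trace ((D^T G D + D^T E + E^T D) S'_t)], where [D = K' - K],
    [G = R + B^T P B] and [E = R K - B^T P F].  Everything about one player is
    read off this identity.  Its linear part shows that the gradient is
    [2 E S_t], so that the natural gradient step is [K - 2 eta E]; the Nash
    equations say that [E = 0]; at the equilibrium it bounds the squared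
    distance of the gains by the gap ([gap_lower]); completing the square bounds
    the gap by the sum of the [|E|^2] ([gradient_domination]); and a step along
    [E + D], with [D] an error, decreases the cost by [|E|^2] up to [|D|^2] as
    soon as [eta G <= 1/2] ([perturbed_step], [contraction_step]).

    The method moves along the [E] computed with the other players' current
    gains, whereas the gap concerns the [E] computed with their equilibrium
    gains.  The difference [D] is caused by the distance of the other players
    from equilibrium, which their own gaps control.  It enters the cost-to-go
    matrices through a backward recursion that inflates errors by at most
    [rho_bar ^ 2] per step, which is where the geometric sum comes from
    ([value_perturb], [natgrad_perturb]).  The cost after the step, which
    multiplies [|D|^2], is bounded by bootstrapping: by the assumptions on the
    parameters and the step size the error term is at most a fifth of it.

    Hence each gap is multiplied by [1 - 2 eta a] up to [2 eta b (N - 1)] times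
    the sum of the other gaps ([one_step]), with [a = sX sR / |Sigma|] and
    [b (N - 1) ^ 2 <= a / 4] by the assumption.  Two consequences of this
    inequality drive the induction: the largest gap never exceeds its initial
    value [psi], which keeps all the bounds in force, and the sum of the gaps
    contracts by [1 - alpha eta <= exp (- alpha eta)].

    The step size has to keep [eta G <= 1/2] only, and [G] is bounded by
    [gamma_R + gamma_B ^ 2 C / sX] for a bound [C] on the costs; since [C] is at
    most twice the sum of the costs of the initial unilateral deviations, a
    monomial in the parameters suffices ([step_size_poly], [step_size_small]).

    That expected costs are these trace formulas rests on two facts about the
    process: Gaussian vectors are square integrable, and the state at time [t]
    is uncorrelated with later noise because it is affine in the initial state
    and the earlier noise ([Sigma_tE], [costE]). *)

(** * Quadratic forms, operator bounds and traces *)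

Section LinAlg.
Context {R : realType}.

Definition dot n (x y : 'cV[R]_n) : R := (x^T *m y) 0 0.

Definition psd n (A : 'M[R]_n) : Prop :=
  A^T = A /\ forall x : 'cV[R]_n, 0 <= quad A x.

(** A bound on the spectral norm, in a form that composes without suprema. *)
Definition opbound m n (A : 'M[R]_(m, n)) (c : R) : Prop :=
  forall x : 'cV[R]_n, l2norm (A *m x) <= c * l2norm x.

Lemma dotE n (x y : 'cV[R]_n) : dot x y = \sum_i x i 0 * y i 0.
Proof. by rewrite /dot mxE; apply: eq_bigr => i _; rewrite mxE. Qed.

Lemma dot_delta n i (x : 'cV[R]_n) : dot (delta_mx i 0) x = x i 0.
Proof.
rewrite dotE (bigD1 i) //= mxE !eqxx mul1r big1 ?addr0 // => j /negPf ji.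
by rewrite mxE ji mul0r.
Qed.

Lemma dotC n (x y : 'cV[R]_n) : dot x y = dot y x.
Proof. by rewrite !dotE; apply: eq_bigr => i _; rewrite mulrC. Qed.

Lemma dotDr n (x y z : 'cV[R]_n) : dot x (y + z) = dot x y + dot x z.
Proof. by rewrite /dot mulmxDr mxE. Qed.

Lemma dotDl n (x y z : 'cV[R]_n) : dot (y + z) x = dot y x + dot z x.
Proof. by rewrite dotC dotDr !(dotC x). Qed.

Lemma dotZr n (x y : 'cV[R]_n) a : dot x (a *: y) = a * dot x y.
Proof. by rewrite /dot -scalemxAr mxE. Qed.

Lemma dotZl n (x y : 'cV[R]_n) a : dot (a *: y) x = a * dot y x.
Proof. by rewrite dotC dotZr dotC. Qed.

Lemma dotNr n (x y : 'cV[R]_n) : dot x (- y) = - dot x y.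
Proof. by rewrite -scaleN1r dotZr mulN1r. Qed.

Lemma dotMr m n (A : 'M[R]_(m, n)) x y : dot x (A *m y) = dot (A^T *m x) y.
Proof. by rewrite /dot trmx_mul trmxK mulmxA. Qed.

Lemma quadE n (A : 'M[R]_n) x : quad A x = dot x (A *m x).
Proof. by rewrite /quad /dot mulmxA. Qed.

Lemma quadD n (A B : 'M[R]_n) x : quad (A + B) x = quad A x + quad B x.
Proof. by rewrite !quadE mulmxDl dotDr. Qed.

Lemma quadN n (A : 'M[R]_n) x : quad (- A) x = - quad A x.
Proof. by rewrite !quadE mulNmx dotNr. Qed.

Lemma quadZ n (A : 'M[R]_n) a x : quad (a *: A) x = a * quad A x.
Proof. by rewrite !quadE -scalemxAl dotZr. Qed.

Lemma quad_scalar n a (x : 'cV[R]_n) : quad a%:M x = a * dot x x.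
Proof. by rewrite quadE mul_scalar_mx dotZr. Qed.

Lemma quad_congr m n (A : 'M[R]_m) (F : 'M[R]_(m, n)) x :
  quad (F^T *m A *m F) x = quad A (F *m x).
Proof. by rewrite !quadE -!mulmxA dotMr trmxK. Qed.

Lemma quad_gram m n (F : 'M[R]_(m, n)) x : quad (F^T *m F) x = dot (F *m x) (F *m x).
Proof. by rewrite quadE -mulmxA dotMr trmxK. Qed.

Lemma dotxx_ge0 n (x : 'cV[R]_n) : 0 <= dot x x.
Proof. by rewrite dotE sumr_ge0 // => i _; rewrite -expr2 sqr_ge0. Qed.

Lemma dotxx_eq0 n (x : 'cV[R]_n) : (dot x x == 0) = (x == 0).
Proof.
apply/eqP/eqP => [|->]; last by rewrite /dot mulmx0 mxE.
rewrite dotE => /eqP; rewrite psumr_eq0 => [/allP xx|i _]; last by rewrite -expr2 sqr_ge0.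
apply/matrixP => i j; rewrite ord1 mxE.
by have := xx i (mem_index_enum _); rewrite /= -expr2 sqrf_eq0 => /eqP.
Qed.

Lemma dotxx_gt0 n (x : 'cV[R]_n) : x != 0 -> 0 < dot x x.
Proof. by move=> x0; rewrite lt_neqAle dotxx_ge0 eq_sym dotxx_eq0 x0. Qed.

Lemma l2normE n (x : 'cV[R]_n) : l2norm x = Num.sqrt (dot x x).
Proof. by rewrite /l2norm dotE; congr Num.sqrt; apply: eq_bigr => i _; rewrite expr2. Qed.

Lemma l2norm_ge0 n (x : 'cV[R]_n) : 0 <= l2norm x.
Proof. by rewrite l2normE sqrtr_ge0. Qed.

Lemma l2norm_sq n (x : 'cV[R]_n) : l2norm x ^+ 2 = dot x x.
Proof. by rewrite l2normE sqr_sqrtr // dotxx_ge0. Qed.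

Lemma l2norm_gt0 n (x : 'cV[R]_n) : x != 0 -> 0 < l2norm x.
Proof. by move=> x0; rewrite l2normE sqrtr_gt0 dotxx_gt0. Qed.

Lemma l2normZ n a (x : 'cV[R]_n) : l2norm (a *: x) = `|a| * l2norm x.
Proof. by rewrite !l2normE dotZr dotZl mulrA -expr2 sqrtrM ?sqr_ge0 // sqrtr_sqr. Qed.

Lemma l2norm0 n : l2norm (0 : 'cV[R]_n) = 0.
Proof. by rewrite -(scale0r 0) l2normZ normr0 mul0r. Qed.

(** The form is nonnegative on every [s x + t y]; the inequality comes from
    [s = quad A y], [t = - dot x (A y)], or from [s = 1] and a suitable [t]
    when [quad A y = 0]. *)
Lemma psd_cauchy_schwarz n (A : 'M[R]_n) x y : psd A ->
  dot x (A *m y) ^+ 2 <= quad A x * quad A y.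
Proof.
move=> [As A0].
have pencil s t : 0 <= s ^+ 2 * quad A x + 2 * s * t * dot x (A *m y) + t ^+ 2 * quad A y.
  have := A0 (s *: x + t *: y).
  rewrite quadE mulmxDr -!scalemxAr !(dotDr, dotDl, dotZl, dotZr) -!quadE.
  rewrite (dotMr A y x) As (dotC (A *m y)); lra.
have := A0 y; rewrite le_eqVlt => /orP[/eqP Ay0|Ay_gt0]; last first.
  have := pencil (quad A y) (- dot x (A *m y)).
  set a := quad A x; set b := dot _ _; set c := quad A y in Ay_gt0 * => H.
  have : 0 <= c * (a * c - b ^+ 2) by lra.
  by rewrite pmulr_rge0 // subr_ge0.
move: (pencil 1) (A0 x); rewrite -Ay0.
set a := quad A x; set b := dot _ _ => H a0.
have [->|b0] := eqVneq b 0; first by rewrite expr0n mulr0.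
have := H (- (a + 1) / (2 * b)).
have -> : 1 ^+ 2 * a + 2 * 1 * (- (a + 1) / (2 * b)) * b + (- (a + 1) / (2 * b)) ^+ 2 * 0 = -1.
  by field.
lra.
Qed.

Lemma psd_scalar n (a : R) : 0 <= a -> psd (a%:M : 'M[R]_n).
Proof. by move=> a0; split=> [|x]; rewrite ?tr_scalar_mx // quad_scalar mulr_ge0 ?dotxx_ge0. Qed.

Lemma cauchy_schwarz n (x y : 'cV[R]_n) : dot x y <= l2norm x * l2norm y.
Proof.
have := psd_cauchy_schwarz x y (@psd_scalar n 1 ler01).
rewrite !quad_scalar !mul1r mul1mx -!l2norm_sq -exprMn => H.
rewrite (le_trans (ler_norm _)) // -(@ler_pXn2r _ 2) ?nnegrE ?normr_ge0 //.
  by rewrite real_normK // num_real.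
by rewrite mulr_ge0 ?l2norm_ge0.
Qed.

Lemma l2normD n (x y : 'cV[R]_n) : l2norm (x + y) <= l2norm x + l2norm y.
Proof.
rewrite -(@ler_pXn2r _ 2) ?nnegrE ?addr_ge0 ?l2norm_ge0 //.
rewrite l2norm_sq dotDr !dotDl sqrrD !l2norm_sq (dotC y x).
have := cauchy_schwarz x y; lra.
Qed.

Lemma l2normN n (x : 'cV[R]_n) : l2norm (- x) = l2norm x.
Proof. by rewrite -scaleN1r l2normZ normrN1 mul1r. Qed.

Lemma opboundD m n (A B : 'M[R]_(m, n)) a b :
  opbound A a -> opbound B b -> opbound (A + B) (a + b).
Proof. by move=> HA HB x; rewrite mulmxDl mulrDl (le_trans (l2normD _ _)) // lerD. Qed.

Lemma opboundN m n (A : 'M[R]_(m, n)) a : opbound A a -> opbound (- A) a.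
Proof. by move=> HA x; rewrite mulNmx l2normN. Qed.

Lemma opbound_sum (I : finType) (S : pred I) m n (F : I -> 'M[R]_(m, n)) f :
  (forall i, S i -> opbound (F i) (f i)) -> opbound (\sum_(i | S i) F i) (\sum_(i | S i) f i).
Proof.
move=> H; elim/big_rec2: _ => [x|i a A Si HA]; last by apply: opboundD => //; exact: H.
by rewrite mul0mx l2norm0 mul0r.
Qed.

Lemma opboundM m n p (A : 'M[R]_(m, n)) (B : 'M[R]_(n, p)) a b : 0 <= a ->
  opbound A a -> opbound B b -> opbound (A *m B) (a * b).
Proof.
by move=> a0 HA HB x; rewrite -mulmxA -mulrA (le_trans (HA _)) // ler_wpM2l.
Qed.

Lemma opbound_le m n (A : 'M[R]_(m, n)) a b : opbound A a -> a <= b -> opbound A b.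
Proof. by move=> HA ab x; rewrite (le_trans (HA x)) // ler_wpM2r ?l2norm_ge0. Qed.

Lemma opbound_tr m n (A : 'M[R]_(m, n)) (a : R) : 0 <= a -> opbound A a -> opbound A^T a.
Proof.
move=> a0 HA x; have [->|nz] := eqVneq (A^T *m x) 0.
  by rewrite l2norm0 mulr_ge0 ?l2norm_ge0.
rewrite -(ler_pM2r (l2norm_gt0 nz)) -[leLHS]expr2 l2norm_sq dotMr trmxK.
by rewrite (le_trans (cauchy_schwarz _ _)) // mulrAC ler_wpM2r ?l2norm_ge0.
Qed.

(** The squared Frobenius norm, written as a trace because that is how it
    enters the cost identities. *)
Definition frob2 m n (A : 'M[R]_(m, n)) : R := \tr (A^T *m A).

Lemma frob2E m n (A : 'M[R]_(m, n)) : frob2 A = \sum_i \sum_j A i j ^+ 2.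
Proof.
rewrite /frob2 /mxtrace exchange_big /=; apply: eq_bigr => j _; rewrite mxE.
by apply: eq_bigr => i _; rewrite mxE expr2.
Qed.

Lemma frob2_ge0 m n (A : 'M[R]_(m, n)) : 0 <= frob2 A.
Proof. by rewrite frob2E; apply: sumr_ge0 => i _; apply: sumr_ge0 => j _; rewrite sqr_ge0. Qed.

Lemma opbound_frob m n (A : 'M[R]_(m, n)) : opbound A (Num.sqrt (frob2 A)).
Proof.
move=> x; rewrite -(@ler_pXn2r _ 2) ?nnegrE ?mulr_ge0 ?sqrtr_ge0 ?l2norm_ge0 //.
rewrite !exprMn (sqr_sqrtr (frob2_ge0 A)) !l2norm_sq frob2E mulr_suml dotE.
apply: ler_sum => i _.
have -> : (A *m x) i 0 = dot (row i A)^T x by rewrite /dot trmxK -row_mul [RHS]mxE.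
rewrite -expr2; have := psd_cauchy_schwarz (row i A)^T x (@psd_scalar n 1 ler01).
rewrite !quad_scalar !mul1r mul1mx => H; apply: (le_trans H).
rewrite ler_wpM2r ?dotxx_ge0 // dotE le_eqVlt; apply/orP; left; apply/eqP.
by apply: eq_bigr => j _; rewrite !mxE expr2.
Qed.

(** Cauchy-Schwarz for the form [M], applied to [x] and [M^-1 x], bounds
    [dot x x ^ 2] by [quad M x * dot x (M^-1 x)]. *)
Lemma psd_unit_coercive n (M : 'M[R]_n) : psd M -> M \in unitmx ->
  exists2 c, 0 < c & forall x, c * dot x x <= quad M x.
Proof.
move=> pM uM; set f := Num.sqrt (frob2 (invmx M)).
have f0 : 0 <= f by rewrite sqrtr_ge0.
exists (f + 1)^-1 => [|x]; first by rewrite invr_gt0; lra.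
have [->|x0] := eqVneq x 0; first by rewrite quadE mulmx0 /dot mulmx0 mxE mulr0.
have := psd_cauchy_schwarz x (invmx M *m x) pM; rewrite mulmxA mulmxV // mul1mx.
rewrite (quadE _ (_ *m x)) mulmxA mulmxV // mul1mx => H.
have B : dot (invmx M *m x) x <= (f + 1) * dot x x.
  rewrite (le_trans (cauchy_schwarz _ _)) // -l2norm_sq.
  have := @opbound_frob _ _ (invmx M) x; rewrite -/f.
  have := l2norm_ge0 x; set p := l2norm x; set q := l2norm _ => p0 qp.
  have := ler_wpM2r p0 qp; nra.
have d0 := dotxx_gt0 x0; have q0 := pM.2 x.
rewrite mulrC ler_pdivrMr ?ltr_wpDl // -(ler_pM2r d0) -expr2 (le_trans H) //.
rewrite -mulrA ler_wpM2l //.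
Qed.

Lemma sym_posdef_psd n (A : 'M[R]_n) : sym_posdef A -> psd A.
Proof.
move=> [As A0]; split=> // x; have [->|/A0/ltW//] := eqVneq x 0.
by rewrite quadE mulmx0 /dot mulmx0 mxE.
Qed.

Lemma sym_posdef_unit n (A : 'M[R]_n) : sym_posdef A -> A \in unitmx.
Proof.
move=> [As A0]; rewrite -row_free_unit -kermx_eq0; apply/eqP/row_matrixP => i; rewrite row0.
apply/eqP; apply: contraT => ri0.
have x0 : (row i (kermx A))^T != 0 by rewrite -(inj_eq (@trmx_inj _ _ _)) trmxK trmx0.
have := A0 _ x0; rewrite /quad trmxK -row_mul mulmx_ker row0 mul0mx mxE ltxx //.
Qed.

(** The infimum [l] of the Rayleigh quotient is an eigenvalue, as otherwise
    [A - l] would be invertible, hence coercive; and it bounds every singular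
    value from below.  So it is the least singular value. *)
Lemma sigma_minP n (A : 'M[R]_n) : (0 < n)%N -> sym_posdef A ->
  0 < sigma_min A /\ forall x, sigma_min A * dot x x <= quad A x.
Proof.
move=> n0 pA; have [As _] := pA; have sA := sym_posdef_psd pA.
have [c c0 cA] := psd_unit_coercive sA (sym_posdef_unit pA).
pose S := [set r | exists2 x : 'cV[R]_n, x != 0 & r = quad A x / dot x x]%classic.
have Slb : lbound S c.
  by move=> _ [x x0 ->]; rewrite ler_pdivlMr ?dotxx_gt0.
have S0 : S !=set0.
  pose v : 'cV[R]_n := delta_mx (Ordinal n0) 0.
  exists (quad A v / dot v v); exists v => //.
  by apply/eqP => /matrixP/(_ (Ordinal n0) 0); rewrite !mxE !eqxx => /eqP; rewrite oner_eq0.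
have hS : has_inf S by split => //; exists c.
set l := inf S.
have l0 : 0 < l by apply: (lt_le_trans c0); apply: lb_le_inf.
have lA x : l * dot x x <= quad A x.
  have [->|x0] := eqVneq x 0; first by rewrite quadE mulmx0 /dot mulmx0 mxE mulr0.
  rewrite -ler_pdivlMr ?dotxx_gt0 //; apply: ge_inf; [by exists c|by exists x].
have lpsd : psd (A - l%:M).
  split=> [|x]; first by rewrite linearB /= As tr_scalar_mx.
  by rewrite quadD quadN quad_scalar subr_ge0.
have nu : A - l%:M \notin unitmx.
  apply/negP => /(psd_unit_coercive lpsd)[e e0 eA].
  have : l + e <= l.
    apply: lb_le_inf => // _ [x x0 ->]; rewrite ler_pdivlMr ?dotxx_gt0 //.
    have := eA x; rewrite quadD quadN quad_scalar; lra.
  lra.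
have [v v0 vA] : exists2 v : 'rV[R]_n, v != 0 & v *m A = l *: v.
  move: nu; rewrite -row_free_unit -kermx_eq0 => /rowV0Pn[v /sub_kermxP vk v0].
  exists v => //; apply/eqP; rewrite -subr_eq0; apply/eqP.
  by rewrite -vk mulmxBr mul_mx_scalar.
have sl : singular_value A l.
  split; first exact: ltW.
  by apply/eigenvalueP; exists v => //; rewrite As mulmxA vA -scalemxAl vA scalerA expr2.
have slb : lbound [set s | singular_value A s]%classic l.
  move=> s [s0 /eigenvalueP[w ws w0]].
  set x := w^T.
  have x0 : x != 0 by rewrite -(inj_eq (@trmx_inj _ _ _)) trmxK trmx0.
  have Ax : l2norm (A *m x) = s * l2norm x.
    rewrite l2normE -quad_gram As quadE.
    have -> : A *m A *m x = s ^+ 2 *: x.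
      by apply: trmx_inj; rewrite !trmx_mul linearZ /= trmxK As -ws As.
    by rewrite dotZr sqrtrM ?sqr_ge0 // sqrtr_sqr ger0_norm // -l2normE.
  have := lA x; rewrite quadE => H; have := le_trans H (cauchy_schwarz x (A *m x)).
  rewrite Ax -l2norm_sq [leRHS]mulrCA -[X in s * X]expr2 ler_pM2r // exprn_gt0 // l2norm_gt0 //.
have el : sigma_min A = l.
  apply/eqP; rewrite eq_le; apply/andP; split.
    by apply: ge_inf => //; exists l.
  by apply: lb_le_inf => //; exists l.
by rewrite el.
Qed.

(** Subtracting [(X e_i) (X e_i)^T / X_ii] from [X] clears row [i] and keeps [X]
    psd, by Cauchy-Schwarz, so that [X] is a sum of dyads [v v^T]; for a dyad the
    trace is [quad Y v].  The induction is on the number of nonzero diagonal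
    entries, since a zero diagonal entry forces a zero row. *)
Lemma psd_trace_ge0 n (X Y : 'M[R]_n) : psd X -> psd Y -> 0 <= \tr (X *m Y).
Proof.
move=> pX pY; move: {2}#|_| (leqnn #|[pred i | X i i != 0]|) => m.
elim: m X pX => [|m IH] X pX.
all: have [Xs X0] := pX.
all: have dq i : quad X (delta_mx i 0) = X i i by rewrite quadE -colE dot_delta mxE.
all: have row0 i : X i i = 0 -> forall j, X i j = 0.
1,3: move=> Xi j; have := psd_cauchy_schwarz (delta_mx i 0) (delta_mx j 0) pX; rewrite !dq Xi mul0r.
1,2: rewrite -colE dot_delta mxE => H; apply/eqP.
1,2: by rewrite -sqrf_eq0 eq_le H sqr_ge0.
  rewrite leqn0 => /eqP/card0_eq d0; suff -> : X = 0 by rewrite mul0mx mxtrace0.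
  by apply/matrixP => i j; rewrite mxE row0 //; have := d0 i; rewrite !inE => /negbFE/eqP.
move=> Xm; have [[i Xi]|none] := pselect (exists i, X i i != 0); last first.
  suff -> : X = 0 by rewrite mul0mx mxtrace0.
  apply/matrixP => i j; rewrite mxE row0 //; apply/eqP; apply: contraT => Xi.
  by case: none; exists i.
have Xi0 : 0 < X i i by rewrite lt_neqAle eq_sym Xi -dq X0.
pose v := col i X; pose X' := X - (X i i)^-1 *: (v *m v^T).
have vE j : v j 0 = X j i by rewrite mxE.
have XsE j k : X j k = X k j by rewrite -{1}Xs mxE.
have X'E j k : X' j k = X j k - (X i i)^-1 * (X i j * X i k).
  by rewrite !mxE big_ord1 !mxE !(XsE i).
have pX' : psd X'.
  split=> [|x]; first by apply/matrixP => j k; rewrite mxE !X'E (XsE k) (mulrC (X i k)).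
  rewrite quadD quadN quadZ subr_ge0 mulrC ler_pdivrMr //.
  rewrite -{1}[v]trmxK quad_gram.
  have := psd_cauchy_schwarz x (delta_mx i 0) pX; rewrite dq -colE -/v => H; apply: le_trans H.
  by rewrite dotE big_ord1 -expr2 -/(dot _ _) dotC.
have -> : \tr (X *m Y) = \tr (X' *m Y) + (X i i)^-1 * quad Y v.
  have vvY : \tr (v *m v^T *m Y) = quad Y v.
    by rewrite -mulmxA mxtrace_mulC /quad [LHS]big_ord1.
  by rewrite mulmxBl -scalemxAl linearB /= linearZ /= vvY subrK.
apply: addr_ge0; last by rewrite mulr_ge0 ?(pY.2) // invr_ge0 ltW.
apply: IH => //; rewrite -ltnS; apply: leq_trans Xm; apply: proper_card.
apply/properP; split.
  apply/fintype.subsetP => j; rewrite !inE; apply: contra_neq => Xj.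
  by rewrite X'E Xj (XsE i j) (row0 j) // mul0r mulr0 subrr.
exists i; rewrite !inE // negbK X'E mulrA mulVf // mul1r subrr //.
Qed.


Lemma psdD n (A B : 'M[R]_n) : psd A -> psd B -> psd (A + B).
Proof.
move=> [As A0] [Bs B0]; split=> [|x]; first by rewrite linearD /= As Bs.
by rewrite quadD addr_ge0.
Qed.

Lemma psdZ n (a : R) (A : 'M[R]_n) : 0 <= a -> psd A -> psd (a *: A).
Proof.
move=> a0 [As A0]; split=> [|x]; first by rewrite linearZ /= As.
by rewrite quadZ mulr_ge0.
Qed.

Lemma psd_congr m n (A : 'M[R]_m) (F : 'M[R]_(m, n)) : psd A -> psd (F^T *m A *m F).
Proof.
move=> [As A0]; split=> [|x]; first by rewrite !trmx_mul trmxK As mulmxA.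
by rewrite quad_congr.
Qed.

Lemma psd_gram m n (F : 'M[R]_(m, n)) : psd (F^T *m F).
Proof.
split=> [|x]; first by rewrite trmx_mul trmxK.
by rewrite quad_gram dotxx_ge0.
Qed.

Lemma psd_shift n (A : 'M[R]_n) (c : R) : A^T = A ->
  (forall x, c * dot x x <= quad A x) -> psd (A - c%:M).
Proof.
move=> As Ac; split=> [|x]; first by rewrite linearB /= tr_scalar_mx As.
by rewrite quadD quadN quad_scalar subr_ge0.
Qed.

Lemma psd_trace_ge n (X Y : 'M[R]_n) (c : R) : psd X -> psd (Y - c%:M) ->
  c * \tr X <= \tr (X *m Y).
Proof.
move=> pX pY; have := psd_trace_ge0 pX pY.
by rewrite mulmxBr mul_mx_scalar linearB /= linearZ /= subr_ge0.
Qed.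

Lemma psd_trace_le n (X Y : 'M[R]_n) (c : R) : psd X -> psd (c%:M - Y) ->
  \tr (X *m Y) <= c * \tr X.
Proof.
move=> pX pY; have := psd_trace_ge0 pX pY.
by rewrite mulmxBr mul_mx_scalar linearB /= linearZ /= subr_ge0.
Qed.

Lemma psd_tr_ge0 n (X : 'M[R]_n) : psd X -> 0 <= \tr X.
Proof.
by move=> pX; rewrite -[X]mulmx1 psd_trace_ge0 //; apply: psd_scalar.
Qed.

(** [quad X x] is the trace of [X x x^T], and [x x^T] is at most
    [dot x x] times the identity. *)
Lemma psd_quad_le_tr n (X : 'M[R]_n) x : psd X -> quad X x <= \tr X * dot x x.
Proof.
move=> pX; have -> : quad X x = \tr (X *m (x *m x^T)).
  by rewrite mulmxA mxtrace_mulC mulmxA /quad [RHS]big_ord1.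
rewrite mulrC; apply: psd_trace_le => //; split=> [|y].
  by rewrite linearB /= tr_scalar_mx trmx_mul trmxK.
rewrite quadD quadN quad_scalar subr_ge0 -{1}[x]trmxK quad_gram.
rewrite (_ : dot _ _ = dot x y ^+ 2); last by rewrite dotE big_ord1 -expr2 /dot.
have := psd_cauchy_schwarz x y (@psd_scalar n 1 ler01).
by rewrite !quad_scalar !mul1r mul1mx.
Qed.

(** Cauchy-Schwarz for the form [P] at [P x] and [x]. *)
Lemma psd_opbound n (P : 'M[R]_n) (p : R) : psd P -> 0 <= p ->
  (forall x, quad P x <= p * dot x x) -> opbound P p.
Proof.
move=> pP p0 Pp x; have [->|y0] := eqVneq (P *m x) 0.
  by rewrite l2norm0 mulr_ge0 ?l2norm_ge0.
have d0 := dotxx_gt0 y0.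
rewrite -(@ler_pXn2r _ 2) ?nnegrE ?mulr_ge0 ?l2norm_ge0 // exprMn !l2norm_sq.
rewrite -(ler_pM2r d0) -[leLHS]expr2.
apply: (le_trans (psd_cauchy_schwarz (P *m x) x pP)).
have q0 := pP.2 x; have := Pp x; have := Pp (P *m x).
move: (quad P x) q0 (quad P _) (dot _ _) d0 (dot x x) => q q0 r d d0 e H1 H2.
have := ler_wpM2r q0 H1; have := ler_wpM2l (mulr_ge0 p0 (ltW d0)) H2; nra.
Qed.

Lemma opbound_gram m n (D : 'M[R]_(m, n)) (c : R) : 0 <= c -> opbound D c ->
  psd ((c ^+ 2)%:M - D^T *m D).
Proof.
move=> c0 HD; split=> [|x].
  by rewrite linearB /= tr_scalar_mx trmx_mul trmxK.
rewrite quadD quadN quad_gram quad_scalar subr_ge0 -!l2norm_sq -exprMn.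
by rewrite ler_pXn2r ?nnegrE ?mulr_ge0 ?l2norm_ge0.
Qed.

Lemma spectral_normP m n (A : 'M[R]_(m, n)) : opbound A (spectral_norm A).
Proof.
have ub : has_ubound [set l2norm (A *m x) | x in [set x : 'cV[R]_n | l2norm x <= 1]].
  exists (Num.sqrt (frob2 A)) => _ [x /= x1 <-].
  by rewrite (le_trans (opbound_frob A x)) // ler_piMr ?sqrtr_ge0.
move=> x; have [->|x0] := eqVneq x 0; first by rewrite mulmx0 !l2norm0 mulr0.
have n0 := l2norm_gt0 x0; rewrite -ler_pdivrMr //; apply: ub_le_sup => //.
exists ((l2norm x)^-1 *: x); rewrite /= ?l2normZ.
  by rewrite ger0_norm ?invr_ge0 ?l2norm_ge0 // mulVf ?gt_eqF.
by rewrite -scalemxAr l2normZ ger0_norm ?invr_ge0 ?l2norm_ge0 // mulrC.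
Qed.

Lemma spectral_norm_ge0 m n (A : 'M[R]_(m, n)) : 0 <= spectral_norm A.
Proof.
apply: ub_le_sup; last by exists 0; rewrite /= ?mulmx0 l2norm0 ?ler01.
exists (Num.sqrt (frob2 A)) => _ [x /= x1 <-].
by rewrite (le_trans (opbound_frob A x)) // ler_piMr ?sqrtr_ge0.
Qed.

Lemma opbound_quad n (A : 'M[R]_n) (c : R) x : opbound A c -> quad A x <= c * dot x x.
Proof.
move=> Ac; rewrite quadE (le_trans (cauchy_schwarz _ _)) // -l2norm_sq expr2 mulrCA.
by rewrite ler_wpM2l ?l2norm_ge0.
Qed.

End LinAlg.

(** * Linear-quadratic costs along a trajectory *)

Section Trajectory.
Context {R : realType} (n T : nat) (S0 W : 'M[R]_n).
Implicit Types (F M P : nat -> 'M[R]_n).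

Fixpoint cov F (t : nat) : 'M[R]_n :=
  if t is s.+1 then F s *m cov F s *m (F s)^T + W else S0.

(** Indexed by the number [m] of remaining steps, to recurse backwards in
    time; [value] converts to the time index. *)
Fixpoint togo F M (MT : 'M[R]_n) (m : nat) : 'M[R]_n :=
  if m is p.+1 then
    M (T - m)%N + (F (T - m)%N)^T *m togo F M MT p *m F (T - m)%N
  else MT.

Definition value F M MT t : 'M[R]_n := togo F M MT (T - t).

Lemma value_last F M MT : value F M MT T = MT.
Proof. by rewrite /value subnn. Qed.

Lemma value_step F M MT t : (t < T)%N ->
  value F M MT t = M t + (F t)^T *m value F M MT t.+1 *m F t.
Proof.
by move=> tT; rewrite /value -(subnSK tT) /= subnSK // subKn // ltnW.
Qed.

Lemma value_ind F M MT (Pr : nat -> 'M[R]_n -> Prop) :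
  Pr T MT ->
  (forall t X, (t < T)%N -> Pr t.+1 X -> Pr t (M t + (F t)^T *m X *m F t)) ->
  forall t, (t <= T)%N -> Pr t (value F M MT t).
Proof.
move=> PT Pstep t tT; rewrite -(subKn tT); elim: (T - t)%N (leq_subr t T) => [|m IH] mT.
  by rewrite subn0 value_last.
have lt : (T - m.+1 < T)%N by rewrite ltn_subrL; case: T mT.
rewrite value_step //; apply: Pstep => //; rewrite subnSK //.
exact: IH (ltnW mT).
Qed.

Lemma value_psd F M MT t : (t <= T)%N -> psd MT ->
  (forall s, (s < T)%N -> psd (M s)) -> psd (value F M MT t).
Proof.
move=> tT pT pM; apply: (@value_ind F M MT (fun _ => @psd R n)) => // s X sT pX.
by apply: psdD; [exact: pM|exact: psd_congr].
Qed.

Lemma value_unique F M MT P : P T = MT ->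
  (forall t, (t < T)%N -> P t = M t + (F t)^T *m P t.+1 *m F t) ->
  forall t, (t <= T)%N -> P t = value F M MT t.
Proof.
move=> PT Pstep; apply: (@value_ind F M MT (fun t X => P t = X)) => // t X tT <-.
exact: Pstep.
Qed.

Definition traj_cost F M MT : R :=
  \sum_(t < T) \tr (M t *m cov F t) + \tr (MT *m cov F T).

Lemma tr_cov_step F X t : \tr (X *m cov F t.+1) =
  \tr ((F t)^T *m X *m F t *m cov F t) + \tr (X *m W).
Proof.
rewrite /= mulmxDr linearD /=; congr (_ + _).
by rewrite !mulmxA mxtrace_mulC !mulmxA.
Qed.

(** Telescoping of [trace (P t * cov t)].  The potential [P] is arbitrary: the
    value matrices of another closed loop give the cost difference below. *)
Lemma traj_cost_telescope F M MT P : P T = MT ->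
  traj_cost F M MT = \tr (P 0%N *m S0) + \sum_(t < T) \tr (P t.+1 *m W)
    + \sum_(t < T) \tr ((M t + (F t)^T *m P t.+1 *m F t - P t) *m cov F t).
Proof.
move=> PT; rewrite /traj_cost -PT => {PT MT}.
elim: T => [|m IH]; first by rewrite !big_ord0 add0r !addr0.
rewrite !big_ord_recr /= [LHS]addrAC; move: IH.
have := tr_cov_step F (P m.+1) m; rewrite /= => ->.
rewrite !mulmxDl mulNmx !linearD /= linearN /=.
set x := \sum_(_ < _) _; set y := \sum_(_ < _) _; set z := \sum_(_ < _) _; lra.
Qed.

Lemma traj_cost_value F M MT : traj_cost F M MT =
  \tr (value F M MT 0 *m S0) + \sum_(t < T) \tr (value F M MT t.+1 *m W).
Proof.
rewrite (traj_cost_telescope F M (value_last F M MT)) [X in _ + X]big1 ?addr0 // => t _.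
by rewrite -value_step // subrr mul0mx mxtrace0.
Qed.

Lemma cov_psd F t : psd S0 -> psd W -> psd (cov F t).
Proof.
move=> p0 pW; elim: t => //= t IH; apply: psdD => //.
by rewrite -{1}[F t]trmxK; exact: psd_congr.
Qed.

Lemma cov_sub F t (c : R) : psd S0 -> psd W -> psd (S0 - c%:M) -> psd (W - c%:M) ->
  psd (cov F t - c%:M).
Proof.
move=> p0 pW c0 cW; case: t => //= t; rewrite -addrA; apply: psdD => //.
by rewrite -{1}[F t]trmxK; apply: psd_congr; exact: cov_psd.
Qed.

(** The cost splits at time [t] into the nonnegative cost of the past, the
    future cost [trace (P_t S_t)] and the cost of the future noise. *)
Lemma tr_value_cov_le F M MT t : psd S0 -> psd W -> psd MT ->
  (forall s, (s < T)%N -> psd (M s)) -> (t <= T)%N ->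
  \tr (value F M MT t *m cov F t) <= traj_cost F M MT.
Proof.
move=> p0 pW pT pM tT.
have step s : (s <= T)%N ->
    \tr (value F M MT s *m cov F s) <=
    \tr (value F M MT 0 *m S0) + \sum_(s' < s) \tr (value F M MT s'.+1 *m W).
  elim: s => [|s IH] sT; first by rewrite big_ord0 addr0.
  rewrite big_ord_recr /= addrA -/(cov F s.+1) tr_cov_step lerD2r.
  apply: le_trans (IH (ltnW sT)); rewrite (value_step F M MT sT) mulmxDl linearD /= lerDr.
  by apply: psd_trace_ge0; [exact: pM|exact: cov_psd].
apply: (le_trans (step _ tT)); rewrite traj_cost_value lerD2l.
rewrite -!(big_mkord xpredT (fun s => \tr (value F M MT s.+1 *m W))).
rewrite [leRHS](big_cat_nat (leq0n t) tT) /= lerDl big_nat_cond.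
apply: sumr_ge0 => s /andP[/andP[_ sT] _].
by apply: psd_trace_ge0 => //; apply: value_psd.
Qed.

End Trajectory.

Lemma trmxDE (R : realType) m n (X Y : 'M[R]_(m, n)) : (X + Y)^T = X^T + Y^T.
Proof. exact: linearD. Qed.

Lemma trmxNE (R : realType) m n (X : 'M[R]_(m, n)) : (- X)^T = - X^T.
Proof. exact: linearN. Qed.

Section Agent.
Context {R : realType} (n k T : nat) (S0 W : 'M[R]_n).
Variables (Ah : nat -> 'M[R]_n) (B : nat -> 'M[R]_(n, k)).
Variables (Rm : nat -> 'M[R]_k) (Q : nat -> 'M[R]_n).
Implicit Types K : nat -> 'M[R]_(k, n).

Definition loop K t := Ah t - B t *m K t.
Definition stage K t := Q t + (K t)^T *m Rm t *m K t.
Definition cost_to_go K t := value T (loop K) (stage K) (Q T) t.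
Definition lqcost K := traj_cost T S0 W (loop K) (stage K) (Q T).
(** Half the Hessian of the cost in the gain at time [t], up to the factor
    [cov t]. *)
Definition curvature K t := Rm t + (B t)^T *m cost_to_go K t.+1 *m B t.
(** Half the natural gradient: the gradient in the gain at time [t] is
    [2 * natgrad K t * cov t]. *)
Definition natgrad K t := Rm t *m K t - (B t)^T *m cost_to_go K t.+1 *m loop K t.

Lemma stage_diff K K' t :
  (cost_to_go K t.+1)^T = cost_to_go K t.+1 -> (Rm t)^T = Rm t -> (t < T)%N ->
  let D := K' t - K t in
  stage K' t + (loop K' t)^T *m cost_to_go K t.+1 *m loop K' t - cost_to_go K t =
  D^T *m curvature K t *m D + D^T *m natgrad K t + (natgrad K t)^T *m D.
Proof.
move=> Ps Rs tT D; rewrite {2}/cost_to_go value_step // -/(cost_to_go K t.+1) /curvature /natgrad.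
have -> : loop K' t = loop K t - B t *m D.
  by rewrite /loop /D mulmxBr opprB addrA addrNK.
have -> : stage K' t = Q t + (K t + D)^T *m Rm t *m (K t + D).
  by rewrite /D subrKC.
rewrite /stage; move: (cost_to_go K t.+1) Ps (loop K t) (K t) D (Rm t) Rs (B t) (Q t).
move=> P Ps L X D r rs b q.
rewrite !(trmxDE, trmxNE, trmx_mul, trmxK) Ps rs.
rewrite !(mulmxDl, mulmxDr, mulmxBl, mulmxBr, mulmxN, mulNmx, mulmxA).
move: (L^T *m P *m L) (L^T *m P *m b *m D) (D^T *m b^T *m P *m L).
move: (D^T *m b^T *m P *m b *m D) (X^T *m r *m X) (X^T *m r *m D) (D^T *m r *m X) (D^T *m r *m D).
move=> x1 x2 x3 x4 x5 x6 x7 x8.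
by apply/matrixP => i j; rewrite !mxE; ring.
Qed.

End Agent.

(** * Bounds for a single agent *)

(** The right-hand side is psd as soon as [C >= r > 0], so that the quadratic
    model [D^T C D + D^T E + E^T D] of the cost is at least [- E^T E / r]. *)
Lemma complete_square (R : realType) k n (C : 'M[R]_k) (D E : 'M[R]_(k, n)) (r : R) :
  r != 0 ->
  r^-1 *: (E^T *m E) + (D^T *m C *m D + D^T *m E + E^T *m D) =
  D^T *m (C - r%:M) *m D + r *: ((D + r^-1 *: E)^T *m (D + r^-1 *: E)).
Proof.
move=> r0; have -> : (D + r^-1 *: E)^T = D^T + r^-1 *: E^T by rewrite !(trmxDE, trmxNE, linearZ).
rewrite !(mulmxDl, mulmxDr, mulmxN, mulNmx, mul_mx_scalar, =^~ scalemxAl, =^~ scalemxAr).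
move: (D^T *m _ *m D) (D^T *m D) (D^T *m E) (E^T *m D) (E^T *m E) => x1 x2 x3 x4 x5.
by apply/matrixP => i j; rewrite !mxE; field.
Qed.

(** The right-hand side is psd when [C <= g], [0 <= e] and [e g <= 1/2].  Then
    the step [- 2 e F], with [F] close to [E], changes the quadratic model of the
    cost by at most [2 e] times [(F - E)^T (F - E) - E^T E]. *)
Lemma gradient_square (R : realType) k n (C : 'M[R]_k) (E F : 'M[R]_(k, n)) (e g : R) :
  (2 * e) *: ((F - E)^T *m (F - E)) - (2 * e) *: (E^T *m E) -
    ((- (2 * e) *: F)^T *m C *m (- (2 * e) *: F) +
     (- (2 * e) *: F)^T *m E + E^T *m (- (2 * e) *: F)) =
  (4 * e ^+ 2) *: (F^T *m (g%:M - C) *m F) + (2 * e * (1 - 2 * (e * g))) *: (F^T *m F).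
Proof.
have -> : (F - E)^T = F^T - E^T by rewrite !(trmxDE, trmxNE, linearZ).
have -> : (- (2 * e) *: F)^T = - (2 * e) *: F^T by rewrite linearZ.
rewrite !(mulmxDl, mulmxDr, mulmxN, mulNmx, mul_mx_scalar, =^~ scalemxAl, =^~ scalemxAr).
move: (F^T *m _ *m F) (F^T *m F) (F^T *m E) (E^T *m F) (E^T *m E) => x1 x2 x3 x4 x5.
by apply/matrixP => i j; rewrite !mxE; ring.
Qed.

Lemma trace_mulDl (R : realType) n (X Y Z : 'M[R]_n) :
  \tr ((X + Y) *m Z) = \tr (X *m Z) + \tr (Y *m Z).
Proof. by rewrite mulmxDl linearD. Qed.

Lemma trace_mulNl (R : realType) n (X Z : 'M[R]_n) : \tr (- X *m Z) = - \tr (X *m Z).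
Proof. by rewrite mulNmx linearN. Qed.

Lemma trace_mulZl (R : realType) n (a : R) (X Z : 'M[R]_n) :
  \tr (a *: X *m Z) = a * \tr (X *m Z).
Proof. by rewrite -scalemxAl linearZ. Qed.

Lemma psd_of_sub (R : realType) m (A : 'M[R]_m) (c : R) : 0 <= c -> psd (A - c%:M) -> psd A.
Proof. by move=> c0 pA; rewrite -[A](subrK c%:M); apply: psdD => //; exact: psd_scalar. Qed.

(** The uniform positivity that makes a linear-quadratic problem well posed,
    with its constants. *)
Record regular (R : realType) (n k T : nat) (S0 W : 'M[R]_n)
    (Rm : nat -> 'M[R]_k) (Q : nat -> 'M[R]_n) (sX sR sQ : R) : Prop := Regular {
  regular_sX : 0 < sX;
  regular_sR : 0 < sR;
  regular_sQ : 0 < sQ;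
  regular_S0 : psd (S0 - sX%:M);
  regular_W : psd (W - sX%:M);
  regular_R : forall t, (t < T)%N -> psd (Rm t - sR%:M);
  regular_Q : forall t, (t <= T)%N -> psd (Q t - sQ%:M) }.

Section AgentBounds.
Context {R : realType} {n k T : nat} {S0 W : 'M[R]_n}.
Context {Ah : nat -> 'M[R]_n} {B : nat -> 'M[R]_(n, k)}.
Context {Rm : nat -> 'M[R]_k} {Q : nat -> 'M[R]_n} {sX sR sQ : R}.
Hypothesis reg : regular T S0 W Rm Q sX sR sQ.
Implicit Types K : nat -> 'M[R]_(k, n).

Local Notation loop := (loop Ah B).
Local Notation stage := (stage Rm Q).
Local Notation cost_to_go := (cost_to_go T Ah B Rm Q).
Local Notation lqcost := (lqcost T S0 W Ah B Rm Q).
Local Notation curvature := (curvature T Ah B Rm Q).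
Local Notation natgrad := (natgrad T Ah B Rm Q).
Local Notation cv K t := (cov S0 W (loop K) t).

Let sX0 := regular_sX reg.
Let sR0 := regular_sR reg.
Let sQ0 := regular_sQ reg.
Let S0sX := regular_S0 reg.
Let WsX := regular_W reg.
Let RsR := regular_R reg.
Let QsQ := regular_Q reg.
Let pS0 : psd S0 := psd_of_sub (ltW sX0) S0sX.
Let pW : psd W := psd_of_sub (ltW sX0) WsX.
Let pR t (tT : (t < T)%N) : psd (Rm t) := psd_of_sub (ltW sR0) (RsR tT).
Let pQ t (tT : (t <= T)%N) : psd (Q t) := psd_of_sub (ltW sQ0) (QsQ tT).

Let stage_psd K t : (t < T)%N -> psd (stage K t).
Proof. by move=> tT; apply: psdD; [exact/pQ/ltnW|exact/psd_congr/pR]. Qed.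

Let cv_psd K t : psd (cv K t).
Proof. exact: cov_psd. Qed.

Let cv_sub K t : psd (cv K t - sX%:M).
Proof. exact: cov_sub. Qed.

Lemma cost_to_go_psd K t : (t <= T)%N -> psd (cost_to_go K t).
Proof. by move=> tT; apply: value_psd => // [|s sT]; [exact: pQ|exact: stage_psd]. Qed.

Lemma curvature_sub K t : (t < T)%N -> psd (curvature K t - sR%:M).
Proof.
move=> tT; rewrite /curvature addrAC; apply: psdD; first exact: RsR.
by apply: psd_congr; exact: cost_to_go_psd.
Qed.

Lemma curvature_psd K t : (t < T)%N -> psd (curvature K t).
Proof. by move=> tT; apply: psd_of_sub (ltW sR0) (curvature_sub K tT). Qed.

Lemma lqcost_diff K K' : lqcost K' = lqcost K + \sum_(t < T)
  \tr (((K' t - K t)^T *m curvature K t *m (K' t - K t) + (K' t - K t)^T *m natgrad K t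
    + (natgrad K t)^T *m (K' t - K t)) *m cv K' t).
Proof.
rewrite {1}/lqcost (@traj_cost_telescope _ _ _ _ _ _ _ _ (cost_to_go K)); last by rewrite /cost_to_go value_last.
rewrite -traj_cost_value -/(lqcost K); congr (_ + _); apply: eq_bigr => t _.
by rewrite -stage_diff //; [case: (cost_to_go_psd K (ltn_ord t))|case: (pR (ltn_ord t))].
Qed.

Lemma tr_cov_ge K t : sX * n%:R <= \tr (cv K t).
Proof.
have := psd_tr_ge0 (cv_sub K t); rewrite linearB /= mxtrace_scalar subr_ge0.
by rewrite mulr_natr.
Qed.

Lemma lqcost_ge_cov K : sQ * \sum_(t < T.+1) \tr (cv K t) <= lqcost K.
Proof.
rewrite /lqcost /traj_cost mulr_sumr big_ord_recr /= lerD //; last first.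
  by rewrite mxtrace_mulC psd_trace_ge //; exact: QsQ.
apply: ler_sum => t _; rewrite /stage mulmxDl linearD /= -[leLHS]addr0 lerD //.
  by rewrite mxtrace_mulC psd_trace_ge //; exact/QsQ/ltnW.
by apply: psd_trace_ge0 => //; apply: psd_congr; exact: pR.
Qed.

Lemma lqcost_ge_cov_stages K : sQ * \sum_(t < T) \tr (cv K t) <= lqcost K.
Proof.
apply: le_trans (lqcost_ge_cov K); rewrite ler_pM2l // big_ord_recr /= lerDl.
exact: psd_tr_ge0.
Qed.

Lemma lqcost_ge K : (0 < n)%N -> sQ * sX <= lqcost K.
Proof.
move=> n0; apply: le_trans (lqcost_ge_cov K); rewrite ler_pM2l // big_ord_recr /=.
have : 0 <= \sum_(t < T) \tr (cv K t) by apply: sumr_ge0 => t _; exact: psd_tr_ge0.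
have := tr_cov_ge K T; have : sX <= sX * n%:R by rewrite ler_peMr ?ler1n // ltW.
lra.
Qed.

(** The future cost [trace (P_t S_t)] is part of the total cost and is at least
    [sX * trace P_t]. *)
Lemma cost_to_go_bound K t x : (t <= T)%N -> quad (cost_to_go K t) x <= lqcost K / sX * dot x x.
Proof.
move=> tT; apply: le_trans (psd_quad_le_tr x (cost_to_go_psd K tT)) _.
rewrite ler_wpM2r ?dotxx_ge0 // ler_pdivlMr // mulrC.
apply: le_trans (psd_trace_ge (cost_to_go_psd K tT) (cv_sub K t)) _.
by apply: tr_value_cov_le => // [|s sT]; [exact: pQ|exact: stage_psd].
Qed.

(** Around a stationary gain the cost difference is purely quadratic. *)
Lemma gap_lower K Ks : (forall t, (t < T)%N -> natgrad Ks t = 0) ->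
  sR * sX * \sum_(t < T) frob2 (K t - Ks t) <= lqcost K - lqcost Ks.
Proof.
move=> a0; rewrite (lqcost_diff Ks K) addrAC subrr add0r mulr_sumr.
apply: ler_sum => t _; rewrite a0 // trmx0 mulmx0 mul0mx !addr0.
move: (K t - Ks t) => D.
apply: (@le_trans _ _ (sR * \tr ((D^T *m D) *m cv K t))).
  rewrite -mulrA ler_pM2l //; apply: psd_trace_ge => //; exact: psd_gram.
have := psd_trace_ge0 (psd_congr D (curvature_sub Ks (ltn_ord t))) (cv_psd K t).
rewrite mulmxBr mul_mx_scalar mulmxBl -scalemxAl mulmxBl -scalemxAl linearB /= linearZ /=.
by rewrite subr_ge0.
Qed.

(** Completing the square in the deviation from [K] turns the exact cost
    difference into a gradient-domination inequality. *)
Lemma gradient_domination K Ks (s : R) :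
  (forall t, (t < T)%N -> psd (s%:M - cv Ks t)) ->
  lqcost K - lqcost Ks <= s / sR * \sum_(t < T) frob2 (natgrad K t).
Proof.
move=> sP; rewrite (lqcost_diff K Ks) opprD addrA subrr add0r -sumrN mulr_sumr.
apply: ler_sum => t _; move: (Ks t - K t) => D; set E := natgrad K t.
have pc := cv_psd Ks t.
have H : psd ((sR^-1) *: (E^T *m E) + (D^T *m curvature K t *m D + D^T *m E + E^T *m D)).
  rewrite [X in psd X](_ : _ = D^T *m (curvature K t - sR%:M) *m D
      + sR *: ((D + sR^-1 *: E)^T *m (D + sR^-1 *: E))).
    apply: psdD; first exact/psd_congr/curvature_sub.
    by apply: psdZ; [exact: ltW|exact: psd_gram].
  by apply: complete_square; rewrite gt_eqF.
have := psd_trace_ge0 H pc; rewrite trace_mulDl trace_mulZl => H1.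
have := psd_trace_le (psd_gram E) (sP t (ltn_ord t)); rewrite -/(frob2 E) => H2.
have : sR^-1 * \tr (E^T *m E *m cv Ks t) <= sR^-1 * (s * frob2 E).
  by rewrite ler_pM2l ?invr_gt0.
lra.
Qed.

(** The weights on both sides are second moments along the new gain [K'], which
    is why the cost of [K'] appears in the error. *)
Lemma perturbed_step K K' (D : nat -> 'M[R]_(k, n)) (eta g delta : R) :
  0 < eta -> eta * g <= 2^-1 -> 0 <= delta ->
  (forall t, (t < T)%N -> psd (g%:M - curvature K t)) ->
  (forall t, (t < T)%N -> opbound (D t) delta) ->
  (forall t, (t < T)%N -> K' t = K t - (2 * eta) *: (natgrad K t + D t)) ->
  lqcost K' <= lqcost K + 2 * eta * delta ^+ 2 * \sum_(t < T) \tr (cv K' t)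
    - 2 * eta * sX * \sum_(t < T) frob2 (natgrad K t).
Proof.
move=> eta0 etag d0 cg Dd K'E; rewrite (lqcost_diff K K') -[leRHS]addrA lerD2l.
rewrite !mulr_sumr -sumrN -big_split /=; apply: ler_sum => t _.
have tT := ltn_ord t; set E := natgrad K t; set F := E + D t.
have -> : K' t - K t = - (2 * eta) *: F by rewrite K'E // addrC addKr scaleNr.
have pc := cv_psd K' t.
have H : psd ((2 * eta) *: ((D t)^T *m D t) - (2 * eta) *: (E^T *m E) -
   ((- (2 * eta) *: F)^T *m curvature K t *m (- (2 * eta) *: F) +
    (- (2 * eta) *: F)^T *m E + E^T *m (- (2 * eta) *: F))).
  rewrite [X in psd X](_ : _ = (4 * eta ^+ 2) *: (F^T *m (g%:M - curvature K t) *m F)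
     + (2 * eta * (1 - 2 * (eta * g))) *: (F^T *m F)).
    apply: psdD; first by apply: psdZ; [nra|exact/psd_congr/cg].
    by apply: psdZ; [nra|exact: psd_gram].
  have -> : D t = F - E by rewrite /F addrC addKr.
  exact: gradient_square.
have := psd_trace_ge0 H pc.
rewrite trace_mulDl trace_mulNl subr_ge0 [leRHS]trace_mulDl trace_mulNl !trace_mulZl => H1.
apply: (le_trans H1).
have := psd_trace_le pc (opbound_gram d0 (Dd t tT)); rewrite mxtrace_mulC => H2.
have := psd_trace_ge (psd_gram E) (cv_sub K' t); rewrite -/(frob2 E) => H3.
have e2 : 0 <= 2 * eta by lra.
have := ler_wpM2l e2 H2; have := ler_wpM2l e2 H3; lra.
Qed.

(** The error in [perturbed_step] is at most a fifth of the new cost, so the new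
    cost is at most [5/4] of the old one; this removes it from the bound. *)
Lemma contraction_step K K' Ks (D : nat -> 'M[R]_(k, n)) (eta g delta s : R) :
  0 < eta -> eta * g <= 2^-1 -> 0 <= delta -> 0 < s ->
  (forall t, (t < T)%N -> psd (g%:M - curvature K t)) ->
  (forall t, (t < T)%N -> psd (s%:M - cv Ks t)) ->
  (forall t, (t < T)%N -> opbound (D t) delta) ->
  (forall t, (t < T)%N -> K' t = K t - (2 * eta) *: (natgrad K t + D t)) ->
  5 * (2 * eta * delta ^+ 2) <= sQ ->
  lqcost K' - lqcost Ks <= (1 - 2 * eta * (sX * sR / s)) * (lqcost K - lqcost Ks)
    + 2 * eta * (delta ^+ 2 * (5 / 4 * lqcost K) / sQ).
Proof.
move=> eta0 etag d0 s0 cg sP Dd K'E small.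
have H := perturbed_step eta0 etag d0 cg Dd K'E.
have G := gradient_domination K sP.
set e := \sum_(t < T) frob2 _ in H G; set c := \sum_(t < T) \tr _ in H.
have e0 : 0 <= e by apply: sumr_ge0 => t _; exact: frob2_ge0.
have c0 : 0 <= c by apply: sumr_ge0 => t _; exact: psd_tr_ge0.
have cJ : sQ * c <= lqcost K' := lqcost_ge_cov_stages K'.
have dc : 5 * (2 * eta * delta ^+ 2 * c) <= lqcost K'.
  by apply: le_trans cJ; rewrite mulrA ler_wpM2r.
have se : 0 <= 2 * eta * sX * e by rewrite !mulr_ge0 // ltW.
have J54 : lqcost K' <= 5 / 4 * lqcost K by lra.
have cJ' : c <= 5 / 4 * lqcost K / sQ by rewrite ler_pdivlMr // mulrC; lra.
have H2 : 2 * eta * delta ^+ 2 * c <= 2 * eta * (delta ^+ 2 * (5 / 4 * lqcost K) / sQ).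
  rewrite [leRHS](_ : _ = 2 * eta * delta ^+ 2 * (5 / 4 * lqcost K / sQ)); last by ring.
  by rewrite ler_wpM2l // !mulr_ge0 ?sqr_ge0 // ltW.
have H3 : 2 * eta * (sX * sR / s) * (lqcost K - lqcost Ks) <= 2 * eta * sX * e.
  have -> : 2 * eta * sX * e = 2 * eta * (sX * sR / s) * (s / sR * e).
    by field; rewrite !gt_eqF.
  by rewrite ler_wpM2l // !mulr_ge0 ?invr_ge0 // ltW.
lra.
Qed.

End AgentBounds.

(** * Perturbing the other players *)

Section Perturbation.
Context {R : realType}.

Definition geom_sum (r : R) (m : nat) : R := \sum_(i < m) r ^+ i.

Lemma geom_sumS r m : geom_sum r m.+1 = 1 + r * geom_sum r m.
Proof.
rewrite /geom_sum big_ord_recl expr0 mulr_sumr; congr (_ + _).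
by apply: eq_bigr => i _; rewrite exprS.
Qed.

Lemma geom_sum_ge0 r m : 0 <= r -> 0 <= geom_sum r m.
Proof. by move=> r0; apply: sumr_ge0 => i _; rewrite exprn_ge0. Qed.

Lemma geom_sum_le r m n : 0 <= r -> (m <= n)%N -> geom_sum r m <= geom_sum r n.
Proof.
move=> r0 /subnKC <-; elim: (n - m)%N => [|k IH]; first by rewrite addn0.
by rewrite addnS (le_trans IH) // /geom_sum big_ord_recr /= lerDl exprn_ge0.
Qed.

Lemma geom_sumE r m : r != 1 -> geom_sum r m = (r ^+ m - 1) / (r - 1).
Proof.
move=> r1; rewrite subrX1 mulrC mulKf ?subr_eq0 //.
Qed.

(** The difference of the value matrices satisfies a recursion
    [D_t = F^T D_(t+1) F + r_t] with [|r_t| <= 2 rho p e]: a backward step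
    inflates it by [rho ^ 2], whence the geometric sum. *)
Lemma value_perturb n T (F F' M : nat -> 'M[R]_n) (MT : 'M[R]_n) (rho p e : R) :
  0 <= rho -> 0 <= p -> 0 <= e ->
  (forall t, (t < T)%N -> opbound (F t) rho) ->
  (forall t, (t < T)%N -> opbound (F' t) rho) ->
  (forall t, (t < T)%N -> opbound (F t - F' t) e) ->
  (forall t, (t <= T)%N -> opbound (value T F' M MT t) p) ->
  forall t, (t <= T)%N ->
    opbound (value T F M MT t - value T F' M MT t)
            (2 * rho * p * e * geom_sum (rho ^+ 2) (T - t)).
Proof.
move=> rho0 p0 e0 FB F'B dF VB t tT; rewrite -{1 2}(subKn tT).
elim: (T - t)%N (leq_subr t T) => [|m IH] mT.
  rewrite subn0 !value_last subrr => x.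
  by rewrite mul0mx l2norm0 mulr_ge0 ?l2norm_ge0 // /geom_sum big_ord0 mulr0.
have lt : (T - m.+1 < T)%N by rewrite ltn_subrL; case: T mT {FB F'B dF VB IH tT}.
have mT' := ltnW mT; move: (IH mT') (VB (T - m)%N (leq_subr _ _)) => {IH}.
rewrite !(value_step _ _ _ lt) (subnSK mT).
move: (FB _ lt) (F'B _ lt) (dF _ lt).
move: (value T F M MT (T - m)) (value T F' M MT (T - m)) (F _) (F' _) (M _).
move=> X X' L L' q LB L'B dB XB X'B.
have -> : q + L^T *m X *m L - (q + L'^T *m X' *m L') =
    L^T *m (X - X') *m L + (L^T *m X' *m (L - L') + (L - L')^T *m X' *m L').
  rewrite !(trmxDE, trmxNE, mulmxDl, mulmxDr, mulmxN, mulNmx).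
  move: (L^T *m X *m L) (L^T *m X' *m L) (L^T *m X' *m L') (L'^T *m X' *m L') => x1 x2 x3 x4.
  by apply/matrixP => i j; rewrite !mxE; ring.
have LtB := opbound_tr rho0 LB; have dtB := opbound_tr e0 dB.
set G := geom_sum (rho ^+ 2) m in XB; have G0 : 0 <= G by apply: geom_sum_ge0; exact: sqr_ge0.
have X0 : 0 <= 2 * rho * p * e * G by rewrite !mulr_ge0.
apply: (opbound_le (opboundD (opboundM (mulr_ge0 rho0 X0) (opboundM rho0 LtB XB) LB)
  (opboundD (opboundM (mulr_ge0 rho0 p0) (opboundM rho0 LtB X'B) dB)
            (opboundM (mulr_ge0 e0 p0) (opboundM e0 dtB X'B) L'B)))).
rewrite geom_sumS -/G le_eqVlt; apply/orP; left; apply/eqP; ring.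
Qed.

Lemma natgrad_perturb n k T (Ah Ah' : nat -> 'M[R]_n) (B : nat -> 'M[R]_(n, k))
    (Rm : nat -> 'M[R]_k) (Q : nat -> 'M[R]_n) (K : nat -> 'M[R]_(k, n)) (rho p e b : R) :
  0 <= rho -> 0 <= p -> 0 <= e -> 0 <= b ->
  (forall t, (t < T)%N -> opbound (loop Ah B K t) rho) ->
  (forall t, (t < T)%N -> opbound (loop Ah' B K t) rho) ->
  (forall t, (t < T)%N -> opbound (Ah t - Ah' t) e) ->
  (forall t, (t <= T)%N -> opbound (cost_to_go T Ah' B Rm Q K t) p) ->
  (forall t, (t < T)%N -> opbound (B t) b) ->
  forall t, (t < T)%N ->
    opbound (natgrad T Ah B Rm Q K t - natgrad T Ah' B Rm Q K t)
            (2 * b * p * e * geom_sum (rho ^+ 2) T).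
Proof.
move=> rho0 p0 e0 b0 LB L'B dA VB BB t tT.
have dL s : (s < T)%N -> opbound (loop Ah B K s - loop Ah' B K s) e.
  by move=> sT; rewrite /loop opprB addrA addrNK; exact: dA.
have := value_perturb rho0 p0 e0 LB L'B dL VB tT; rewrite -/(cost_to_go _ _ _ _ _ _ _).
rewrite -/(cost_to_go T Ah' B Rm Q K t.+1).
move: (VB t.+1 tT) (LB t tT) (dL t tT) (opbound_tr b0 (BB t tT)); rewrite /natgrad.
move: (cost_to_go T Ah B Rm Q K t.+1) (cost_to_go T Ah' B Rm Q K t.+1) (loop Ah B K t) (loop Ah' B K t).
move=> X X' L L' X'B LtB dtB BtB dX.
have -> : Rm t *m K t - (B t)^T *m X *m L - (Rm t *m K t - (B t)^T *m X' *m L') =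
    - ((B t)^T *m ((X - X') *m L + X' *m (L - L'))).
  rewrite !(mulmxDl, mulmxDr, mulmxN, mulNmx, mulmxA).
  move: (_ *m X *m L) (_ *m X' *m L) (_ *m X' *m L') (Rm t *m K t) => x1 x2 x3 x4.
  by apply/matrixP => i j; rewrite !mxE; ring.
set G := geom_sum (rho ^+ 2) (T - t.+1) in dX.
have G0 : 0 <= G by apply: geom_sum_ge0; exact: sqr_ge0.
have X0 : 0 <= 2 * rho * p * e * G by rewrite !mulr_ge0.
apply/opboundN/(opbound_le (opboundM b0 BtB (opboundD (opboundM X0 dX LtB) (opboundM p0 X'B dtB)))).
have G1 : 1 + rho ^+ 2 * G <= geom_sum (rho ^+ 2) T.
  by rewrite -geom_sumS; apply: geom_sum_le; [exact: sqr_ge0|rewrite subnSK // leq_subr].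
have w0 : 0 <= b * (p * e) by rewrite !mulr_ge0.
have := ler_wpM2l w0 G1; lra.
Qed.

End Perturbation.

Section FiniteExtrema.
Context {R : realType} (I : finType) (i0 : I) (f : I -> R).

Lemma fmaxP : exists i, fmax f = f i /\ forall j, f j <= f i.
Proof.
case: (@Order.TotalTheory.arg_maxP _ _ _ i0 xpredT f) => // i _ fi.
exists i; split => [|j]; last exact: fi.
apply/eqP; rewrite eq_le; apply/andP; split.
  by apply: ge_sup; [exists (f i0); exists i0|move=> _ [j _ <-]; exact: fi].
by apply: ub_le_sup; [exists (f i) => _ [j _ <-]; exact: fi|exists i].
Qed.

Lemma fminP : exists i, fmin f = f i /\ forall j, f i <= f j.
Proof.
case: (@Order.TotalTheory.arg_minP _ _ _ i0 xpredT f) => // i _ fi.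
exists i; split => [|j]; last exact: fi.
apply/eqP; rewrite eq_le; apply/andP; split.
  by apply: ge_inf; [exists (f i) => _ [j _ <-]; exact: fi|exists i].
by apply: lb_le_inf; [exists (f i0); exists i0|move=> _ [j _ <-]; exact: fi].
Qed.

Lemma fmax_ge i : f i <= fmax f.
Proof. by have [j [-> ]] := fmaxP. Qed.

Lemma fmin_le i : fmin f <= f i.
Proof. by have [j [-> ]] := fminP. Qed.

End FiniteExtrema.

(** The double sum of the [(x i - x j) ^ 2] is nonnegative. *)
Lemma sqr_sum_le (R : realFieldType) (I : finType) (S : {pred I}) (x : I -> R) :
  (\sum_(i in S) x i) ^+ 2 <= #|S|%:R * \sum_(i in S) x i ^+ 2.
Proof.
have : 0 <= \sum_(i in S) \sum_(j in S) (x i - x j) ^+ 2.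
  by apply: sumr_ge0 => i _; apply: sumr_ge0 => j _; exact: sqr_ge0.
set q := \sum_(i in S) x i ^+ 2; set s := \sum_(i in S) x i.
rewrite (eq_bigr (fun i => x i ^+ 2 * #|S|%:R - 2 * s * x i + q)); last first.
  move=> i _; rewrite (eq_bigr (fun j => x i ^+ 2 - 2 * x i * x j + x j ^+ 2)).
    rewrite !big_split /= sumr_const sumrN -mulr_sumr -/s -/q mulr_natr; ring.
  by move=> j _; ring.
rewrite !big_split /= sumr_const sumrN -mulr_suml -mulr_sumr -/q -/s -mulr_natr; lra.
Qed.

Lemma derive_quadratic (R : realType) (V : normedModType R) (f : V -> R) (x v : V) (c q : R) :
  (forall h, f (h *: v + x) = f x + h * c + h ^+ 2 * q) -> 'D_v f x = c.
Proof.
move=> fE; apply: cvg_lim => //.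
have lim : (c + h * q) @[h --> 0^'] --> c.
  rewrite -{2}[c]addr0 -{2}(mul0r q); apply: cvg_within_filter.
  by apply: cvgD; [exact: cvg_cst|apply: cvgM; [exact: cvg_id|exact: cvg_cst]].
apply: cvg_trans lim; apply: near_eq_cvg; near=> h.
have h0 : h != 0 by near: h; exact: nbhs_dnbhs_neq.
rewrite /= fE /GRing.scale /=; field.
Unshelve. all: by end_near. Qed.

(** * Gaussian second moments and independence *)

Section GaussianMoments.
Context {R : realType}.
Local Notation mu := (@lebesgue_measure R).
Local Open Scope ereal_scope.

(** The normal density is a Radon-Nikodym derivative of the normal law, hence
    almost everywhere equal to the one supplied by the general theory. *)
Lemma ge0_integral_normal_prob (m s : R) (f : _ -> \bar R) :
  measurable_fun setT f -> (forall x, 0 <= f x) ->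
  \int[normal_prob m s]_x f x = \int[mu]_x (f x * (normal_pdf m s x)%:E).
Proof.
move=> mf f0; have dom := @normal_prob_dominates R m s.
rewrite -(Radon_Nikodym_SigmaFinite.change_of_variables dom) //.
have gi := Radon_Nikodym_SigmaFinite.f_integrable dom.
have mg := measurable_int _ gi.
have mp : measurable_fun setT (EFin \o normal_pdf m s).
  by apply/measurable_EFinP; exact: measurable_normal_pdf.
apply: ae_eq_integral => //.
- exact: emeasurable_funM.
- exact: emeasurable_funM.
apply: ae_eqe_mul2l; apply: integral_ae_eq => //.
by move=> A _ mA; rewrite -Radon_Nikodym_SigmaFinite.f_integral.
Qed.

(** Doubling the standard deviation absorbs the polynomial factor: with
    [u = (x - m)^2 / (8 s^2)] the exponents differ by [3 u], and
    [1 + 3 u <= exp (3 u)]. *)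
Lemma sqr_normal_pdf_le (m s x : R) : (s != 0)%R ->
  (x ^+ 2 * normal_pdf m s x <= normal_peak s / normal_peak (2 * s) *
     (2 * m ^+ 2 + 16 * s ^+ 2) * normal_pdf m (2 * s) x)%R.
Proof.
move=> s0; have s20 : (2 * s != 0)%R by rewrite mulf_neq0.
have p0 := normal_peak_gt0 s0; have p20 := normal_peak_gt0 s20.
rewrite !normal_pdfE //.
rewrite [leRHS](_ : _ = (normal_peak s *
  ((2 * m ^+ 2 + 16 * s ^+ 2) * normal_fun m (2 * s) x))%R); last first.
  by field; rewrite gt_eqF.
rewrite mulrCA ler_pM2l //.
have -> : normal_fun m s x = (normal_fun m (2 * s) x *
    expR (- (3 * ((x - m) ^+ 2 / (8 * s ^+ 2)))))%R.
  by rewrite /normal_fun -expRD; congr expR; field.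
have n0 : (0 < normal_fun m (2 * s) x)%R by exact: expR_gt0.
rewrite mulrCA mulrC ler_pM2r // expRN.
set u := ((x - m) ^+ 2 / (8 * s ^+ 2))%R.
have s2 : (0 < s ^+ 2)%R by rewrite exprn_even_gt0.
have u0 : (0 <= u)%R by rewrite divr_ge0 ?sqr_ge0 // mulr_ge0 // ltW.
have xu : ((x - m) ^+ 2 = 8 * s ^+ 2 * u)%R by rewrite /u; field.
have e1 := expR_ge1Dx (3 * u).
rewrite ler_pdivrMr ?expR_gt0 //.
have m2 := sqr_ge0 m; have xm := sqr_ge0 (x - 2 * m)%R.
apply: (@le_trans _ _ ((2 * m ^+ 2 + 16 * s ^+ 2) * (1 + 3 * u)))%R.
  nra.
by apply: ler_wpM2l => //; lra.
Qed.

Lemma normal_prob_sqr_lty (m s : R) : (s != 0)%R ->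
  \int[normal_prob m s]_x (x ^+ 2)%:E < +oo.
Proof.
move=> s0; rewrite ge0_integral_normal_prob; last 2 first.
- by apply/measurable_EFinP; exact: measurable_funX.
- by move=> x; rewrite lee_fin sqr_ge0.
set C := (normal_peak s / normal_peak (2 * s) * (2 * m ^+ 2 + 16 * s ^+ 2))%R.
apply: (@le_lt_trans _ _ (\int[mu]_x (C%:E * (normal_pdf m (2 * s) x)%:E))).
  apply: ge0_le_integral => //.
  - by move=> x _; rewrite mule_ge0 ?lee_fin ?sqr_ge0 ?normal_pdf_ge0.
  - apply/measurable_EFinP; apply: measurable_funM; first exact: measurable_funX.
    exact: measurable_normal_pdf.
  - apply/measurable_EFinP; apply: measurable_funM => //.
    exact: measurable_normal_pdf.
  - by move=> x _; rewrite -!EFinM lee_fin sqr_normal_pdf_le.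
rewrite integralZl //; last exact: integrable_normal_pdf.
by rewrite integral_normal_pdf mule1 ltry.
Qed.

End GaussianMoments.

Section SquareIntegrable.
Context {R : realType} {disp : measure_display} {Omega : measurableType disp}.
Variable P : probability Omega R.

Lemma Lfun2_of_sqr (f : Omega -> R) : measurable_fun setT f ->
  (\int[P]_w (f w ^+ 2)%:E < +oo)%E -> f \in Lfun P 2%:E.
Proof.
move=> mf fy; rewrite inE; apply/andP; split; rewrite inE //=.
rewrite /finite_norm unlock /Lnorm poweR_lty //.
by under eq_integral => w _ do rewrite /= powR_mulrn // real_normK ?num_real //.
Qed.

(** A coordinate of a Gaussian vector is a linear functional of it, so its law
    is normal or a Dirac mass. *)
Lemma gaussian_Lfun2 n (X : {RV P >-> n.-tuple R}) j : gaussian_vector X ->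
  (fun w => rvec X w j 0) \in Lfun P 2%:E.
Proof.
move=> gX; have [m [s law]] := gX (delta_mx j 0).
pose f w := tnth (X w) j.
have fE : (fun w => rvec X w j 0) = f by apply/funext => w; rewrite mxE.
have mf : measurable_fun setT f.
  by apply: (measurableT_comp (measurable_tnth j)); exact: measurable_funPT.
have lawf (B : set R) : measurable B -> P (f @^-1` B) = gaussian_law m s B.
  move=> mB; rewrite -law //; congr (P (_ @^-1` B)); apply/funext => w.
  by rewrite trmx_delta -rowE !mxE.
rewrite fE; apply: Lfun2_of_sqr => //.
have mf' : @measurable_fun _ _ Omega (measurableTypeR R) setT f by [].
pose F : {mfun Omega >-> measurableTypeR R} :=
  HB.pack f (isMeasurableFun.Build _ _ _ (measurableTypeR R) f mf').
have -> : (\int[P]_w (f w ^+ 2)%:E = \int[distribution P F]_x (x ^+ 2)%:E)%E.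
  rewrite ge0_integral_distribution //.
    by apply/measurable_EFinP; exact: measurable_funX.
  by move=> y; rewrite lee_fin sqr_ge0.
have [s0|s0] := eqVneq s 0.
  rewrite (@eq_measure_integral _ _ _ _ (@dirac _ (measurableTypeR R) m R)); last first.
    by move=> B mB _; apply: etrans (lawf B mB) _; rewrite /gaussian_law s0 eqxx.
  rewrite integral_dirac //; first by rewrite diracT mul1e ltry.
  by apply/measurable_EFinP; exact: measurable_funX.
suff -> : (\int[distribution P F]_x (x ^+ 2)%:E = \int[normal_prob m s]_x (x ^+ 2)%:E)%E.
  exact: normal_prob_sqr_lty.
apply: eq_measure_integral => B mB _.
by apply: etrans (lawf B mB) _; rewrite /gaussian_law (negPf s0).
Qed.

(** The joint law of [f] and [g] is the product of their laws, by uniqueness of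
    the product measure, so that Fubini factors the expectation. *)
Lemma independent_expectationM (f g : Omega -> R) :
  f \in Lfun P 2%:E -> g \in Lfun P 2%:E ->
  (forall A B : set R, measurable A -> measurable B ->
     P (f @^-1` A `&` g @^-1` B) = (P (f @^-1` A) * P (g @^-1` B))%E) ->
  ('E_P[f \* g] = 'E_P[f] * 'E_P[g])%E.
Proof.
move=> f2 g2 ind.
have f1 : f \in Lfun P 1 by apply: Lfun_subset f2 => //; rewrite ?lee1n ?fin_num_measure.
have g1 : g \in Lfun P 1 by apply: Lfun_subset g2 => //; rewrite ?lee1n ?fin_num_measure.
have mf : measurable_fun setT f by move: f2; rewrite inE => /andP[/[!inE]].
have mg : measurable_fun setT g by move: g2; rewrite inE => /andP[/[!inE]].
pose F : {mfun Omega >-> R} := HB.pack f (isMeasurableFun.Build _ _ _ _ f mf).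
pose G : {mfun Omega >-> R} := HB.pack g (isMeasurableFun.Build _ _ _ _ g mg).
have mh : measurable_fun setT (fun w => (f w, g w)) by exact: measurable_fun_pair.
pose h w := (f w, g w).
pose H : {mfun Omega >-> (R * R)%type} := HB.pack h (isMeasurableFun.Build _ _ _ _ h mh).
have mxy : measurable_fun setT (fun z : R * R => (z.1 * z.2)%:E).
  by apply/measurable_EFinP; apply: measurable_funM.
have ifg : P.-integrable setT ((fun z : R * R => (z.1 * z.2)%:E) \o H).
  exact/Lfun1_integrable/Lfun2_mul_Lfun1.
pose xy := fun z : R * R => (z.1 * z.2)%:E.
have joint (C : set (R * R)) : measurable C ->
    (distribution P F \x distribution P G)%E C = distribution P H C.
  by apply: product_measure_unique => A B mA mB; exact: ind.
have ixy : (distribution P F \x distribution P G)%E.-integrable setT xy.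
  apply/integrableP; split=> //.
  rewrite (eq_measure_integral (distribution P H)); last by move=> C mC _; exact: joint.
  by have /integrableP[] := integrable_pushforward (mh : measurable_fun setT H) mxy ifg measurableT.
have ig : P.-integrable setT (EFin \o g) by exact/Lfun1_integrable.
have if_ : P.-integrable setT (EFin \o f) by exact/Lfun1_integrable.
have Eg : (\int[distribution P G]_y y%:E = 'E_P[g])%E.
  by rewrite unlock integral_distribution //; apply/measurable_EFinP.
have Ef : (\int[distribution P F]_y y%:E = 'E_P[f])%E.
  by rewrite unlock integral_distribution //; apply/measurable_EFinP.
have jg : (distribution P G).-integrable setT (fun y => y%:E).
  by apply: (integrable_pushforward mg) => //; apply/measurable_EFinP.
have jf : (distribution P F).-integrable setT (fun y => y%:E).
  by apply: (integrable_pushforward mf) => //; apply/measurable_EFinP.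
rewrite {1}unlock.
transitivity (\int[distribution P H]_z xy z)%E; first by rewrite integral_distribution.
rewrite (eq_measure_integral (distribution P F \x distribution P G)%E); last first.
  by move=> C mC _; apply/esym/joint.
rewrite -integral12_prod_meas1 //.
transitivity (\int[distribution P F]_x (x%:E * 'E_P[g]))%E.
  by apply: eq_integral => x _; rewrite -Eg -integralZl.
by rewrite -Ef; have /fineK <- := expectation_fin_num g1; rewrite integralZr.
Qed.

End SquareIntegrable.

(** * Second moments of random vectors *)

Section CrossMoments.
Context {R : realType} {disp : measure_display} {Omega : measurableType disp}.
Variable P : probability Omega R.
Local Notation L2 := (Lfun P 2%:E).

Definition inner (f g : Omega -> R) : R := fine 'E_P[fun w => f w * g w].

Lemma Lfun2_lin (a : R) (f g : Omega -> R) : f \in L2 -> g \in L2 ->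
  (fun w => a * f w + g w) \in L2.
Proof. exact: (Lfun_submod_closed P (lee1n 2)).2. Qed.

Lemma Lfun2_0 : (fun _ => 0) \in L2.
Proof. exact: (Lfun_submod_closed P (lee1n 2)).1. Qed.

Lemma inner_lin (a : R) (f g h : Omega -> R) : f \in L2 -> g \in L2 -> h \in L2 ->
  inner (fun w => a * f w + g w) h = a * inner f h + inner g h.
Proof.
move=> fL gL hL; have fh := Lfun2_mul_Lfun1 fL hL; have gh := Lfun2_mul_Lfun1 gL hL.
rewrite /inner.
have -> : (fun w => (a * f w + g w) * h w) = (a \o* (f \* h)) \+ (g \* h).
  by apply/funext => w /=; ring.
rewrite expectationD // ?expectationZl //; last exact: Lfun_scale.
have f1 := expectation_fin_num fh; have f2 := expectation_fin_num gh.
by rewrite fineD // ?fineM // fin_numM.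
Qed.

Lemma innerC f g : inner f g = inner g f.
Proof. by rewrite /inner; congr (fine (expectation P _)); apply/funext => w; rewrite mulrC. Qed.

Lemma Lfun2_sum (I : Type) (r : seq I) (a : I -> R) (F : I -> Omega -> R) :
  (forall i, F i \in L2) -> (fun w => \sum_(i <- r) a i * F i w) \in L2.
Proof.
move=> FL; elim: r => [|i r IH].
  by under eq_fun do rewrite big_nil; exact: Lfun2_0.
by under eq_fun do rewrite big_cons; exact: Lfun2_lin.
Qed.

Lemma inner0 h : inner (fun _ => 0) h = 0.
Proof.
by rewrite /inner; under eq_fun do rewrite mul0r; rewrite expectation_cst.
Qed.

Lemma inner_sum (I : Type) (r : seq I) (a : I -> R) (F : I -> Omega -> R) h :
  (forall i, F i \in L2) -> h \in L2 ->
  inner (fun w => \sum_(i <- r) a i * F i w) h = \sum_(i <- r) a i * inner (F i) h.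
Proof.
move=> FL hL; elim: r => [|i r IH].
  by under eq_fun do rewrite big_nil; rewrite big_nil inner0.
under eq_fun do rewrite big_cons; rewrite inner_lin ?IH ?big_cons //.
exact: Lfun2_sum.
Qed.

Definition L2vec n (X : Omega -> 'cV[R]_n) : Prop :=
  forall i, (fun w => X w i 0) \in L2.

Definition cross m n (X : Omega -> 'cV[R]_m) (Y : Omega -> 'cV[R]_n) : 'M[R]_(m, n) :=
  \matrix_(i, j) inner (fun w => X w i 0) (fun w => Y w j 0).

Lemma second_momentE n (X : Omega -> 'cV[R]_n) : second_moment P X = cross X X.
Proof. by []. Qed.

Lemma cross_tr m n (X : Omega -> 'cV[R]_m) (Y : Omega -> 'cV[R]_n) :
  cross Y X = (cross X Y)^T.
Proof. by apply/matrixP => i j; rewrite !mxE innerC. Qed.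

Lemma affineE m n (A : 'M[R]_(m, n)) (X : Omega -> 'cV[R]_n) (Y : Omega -> 'cV[R]_m) i :
  (fun w => (A *m X w + Y w) i 0) =
  (fun w => 1 * (\sum_j A i j * X w j 0) + Y w i 0).
Proof. by apply/funext => w; rewrite !mxE mul1r. Qed.

Lemma L2vec_affine m n (A : 'M[R]_(m, n)) X (Y : Omega -> 'cV[R]_m) :
  L2vec X -> L2vec Y -> L2vec (fun w => A *m X w + Y w).
Proof.
by move=> XL YL i; rewrite affineE; apply: Lfun2_lin => //; exact: Lfun2_sum.
Qed.

Lemma cross_affine m n p (A : 'M[R]_(m, n)) X (Y : Omega -> 'cV[R]_m) (Z : Omega -> 'cV[R]_p) :
  L2vec X -> L2vec Y -> L2vec Z ->
  cross (fun w => A *m X w + Y w) Z = A *m cross X Z + cross Y Z.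
Proof.
move=> XL YL ZL; apply/matrixP => i j; rewrite mxE affineE inner_lin //; last exact: Lfun2_sum.
rewrite mul1r inner_sum // !mxE; congr (_ + _).
by apply: eq_bigr => k _; rewrite mxE.
Qed.

(** The cross terms vanish because [Y] is uncorrelated with [X]. *)
Lemma second_moment_affine m n (A : 'M[R]_(m, n)) X (Y : Omega -> 'cV[R]_m) :
  L2vec X -> L2vec Y -> cross Y X = 0 ->
  second_moment P (fun w => A *m X w + Y w) =
  A *m second_moment P X *m A^T + second_moment P Y.
Proof.
move=> XL YL YX; have AL := L2vec_affine A XL YL.
rewrite !second_momentE cross_affine //.
rewrite (cross_tr (fun w => A *m X w + Y w) X) (cross_tr (fun w => A *m X w + Y w) Y).
rewrite !cross_affine // (cross_tr Y X) YX trmx0 mulmx0 add0r -(cross_tr Y Y) addr0.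
by rewrite trmx_mul -(cross_tr X X) mulmxA.
Qed.

Lemma expectation_quad n (Q : 'M[R]_n) (X : Omega -> 'cV[R]_n) : L2vec X ->
  (fun w => quad Q (X w)) \in Lfun P 1 /\
  'E_P[fun w => quad Q (X w)]%E = (\tr (Q *m second_moment P X))%:E.
Proof.
move=> XL; pose F i w : R := X w i 0 * \sum_j Q i j * X w j 0.
have E : (fun w => quad Q (X w)) = (fun w => \sum_(i <- enum 'I_n) F i w).
  apply/funext => w; rewrite /quad -mulmxA mxE big_enum.
  by apply: eq_bigr => i _; rewrite !mxE.
have F1 i : F i \in Lfun P 1.
  by apply: (Lfun2_mul_Lfun1 (XL i)); exact: Lfun2_sum.
pose S r w : R := \sum_(i <- r) F i w.
have L1 (r : seq 'I_n) : S r \in Lfun P 1 /\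
  'E_P[S r]%E = (\sum_(i <- r) (Q *m second_moment P X) i i)%:E.
  elim: r => [|i r [IH1 IH2]].
    rewrite /S; under eq_fun do rewrite big_nil; rewrite big_nil.
    by split; [exact: Lfun_cst|exact: expectation_cst].
  have -> : S (i :: r) = F i \+ S r by apply/funext => w; rewrite /S big_cons.
  split.
    have := (Lfun_submod_closed P (lexx 1%E)).2 1 _ _ (F1 i) IH1.
    by rewrite scale1r.
  rewrite expectationD // IH2 big_cons EFinD; congr (_ + _)%E.
  have := expectation_fin_num (F1 i) => /fineK <-; congr (_%:E).
  rewrite -/(inner (fun w => X w i 0) (fun w => \sum_j Q i j * X w j 0)) innerC.
  by rewrite inner_sum // mxE; apply: eq_bigr => j _; rewrite mxE.
have [L1a L1b] := L1 (enum 'I_n).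
by rewrite E -/(S (enum 'I_n)) L1b big_enum.
Qed.

End CrossMoments.

(** * The state process of the game *)

Section IndependentVectors.
Context {R : realType} {disp : measure_display} {Omega : measurableType disp}.
Variable P : probability Omega R.

(** The other members of the family are constrained by the whole space. *)
Lemma mutually_independent_pair (I : finType) n (X : I -> {RV P >-> n.-tuple R}) i j
    (A B : set (n.-tuple R)) :
  mutually_independent X -> i != j -> measurable A -> measurable B ->
  P (X i @^-1` A `&` X j @^-1` B) = (P (X i @^-1` A) * P (X j @^-1` B))%E.
Proof.
move=> ind ij mA mB.
pose C k : set (n.-tuple R) := if k == i then A else if k == j then B else setT.
have mC k : measurable (C k) by rewrite /C; case: ifP => // _; case: ifP.
have Ci : C i = A by rewrite /C eqxx.
have Cj : C j = B by rewrite /C eq_sym (negPf ij) eqxx.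
have Ck k : k != i -> k != j -> C k = setT by rewrite /C => /negPf -> /negPf ->.
have := ind C mC; rewrite (bigD1 i) //= (bigD1 j) ?(eq_sym j) //= Ci Cj big1 ?mule1; last first.
  by move=> k /andP[ki kj]; rewrite Ck // preimage_setT probability_setT.
move=> <-; congr (P _); apply/seteqP; split=> [w [wA wB] k _|w wC].
  have [->|ki] := eqVneq k i; first by rewrite Ci.
  have [->|kj] := eqVneq k j; first by rewrite Cj.
  by rewrite Ck.
by split; [have := wC i Logic.I; rewrite Ci|have := wC j Logic.I; rewrite Cj].
Qed.

Lemma cross_independent n (X Y : {RV P >-> n.-tuple R}) :
  (forall A B : set (n.-tuple R), measurable A -> measurable B ->
     P (X @^-1` A `&` Y @^-1` B) = (P (X @^-1` A) * P (Y @^-1` B))%E) ->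
  L2vec P (rvec X) -> L2vec P (rvec Y) -> mean P (rvec X) = 0 ->
  cross P (rvec X) (rvec Y) = 0.
Proof.
move=> ind XL YL m0; apply/matrixP => i j; rewrite !mxE /inner.
pose f w := rvec X w i 0; pose h w := rvec Y w j 0.
have mt k : measurable_fun [set: n.-tuple R] (fun x => tnth x k) by exact: measurable_tnth.
have fL2 : f \in Lfun P 2%:E := XL i.
have hL2 : h \in Lfun P 2%:E := YL j.
rewrite (_ : (fun w => _) = f \* h) // (@independent_expectationM _ _ _ P f h) //.
  have /matrixP/(_ i 0) := m0; rewrite !mxE => f0.
  have fL : f \in Lfun P 1 by apply: Lfun_subset12 (XL i); exact: fin_num_measure.
  have -> : ('E_P[f] = 0)%E by rewrite -(fineK (expectation_fin_num fL)) f0.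
  by rewrite mul0e.
move=> A B mA mB.
have -> : f @^-1` A = X @^-1` ((fun x => tnth x i) @^-1` A).
  by apply/seteqP; split=> w /=; rewrite /f mxE.
have -> : h @^-1` B = Y @^-1` ((fun x => tnth x j) @^-1` B).
  by apply/seteqP; split=> w /=; rewrite /h mxE.
apply: ind; rewrite -[X in measurable X]setTI; exact: mt.
Qed.

Lemma same_law_second_moment n (X Y : {RV P >-> n.-tuple R}) :
  L2vec P (rvec X) -> L2vec P (rvec Y) -> same_law X Y ->
  second_moment P (rvec X) = second_moment P (rvec Y).
Proof.
move=> XL YL sl; apply/matrixP => i j; rewrite !mxE; congr fine.
pose q (x : n.-tuple R) : \bar R := (tnth x i * tnth x j)%:E.
have mq : measurable_fun setT q.
  by apply/measurable_EFinP; apply: measurable_funM; exact: measurable_tnth.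
have law (Z : {RV P >-> n.-tuple R}) : L2vec P (rvec Z) ->
    ('E_P[fun w => (rvec Z w i 0 * rvec Z w j 0)%R] = \int[distribution P Z]_x q x)%E.
  move=> ZL; have qZ : EFin \o (fun w => rvec Z w i 0 * rvec Z w j 0) = q \o Z.
    by apply/funext => w /=; rewrite !mxE.
  rewrite unlock integral_distribution //.
    by apply: eq_integral => w _; rewrite -qZ.
  by rewrite -qZ; apply/Lfun1_integrable; exact: (Lfun2_mul_Lfun1 (ZL i) (ZL j)).
rewrite !law //; apply: eq_measure_integral => A mA _; exact: sl.
Qed.

End IndependentVectors.

Section GameProcess.
Context {R : realType} (g : lq_game R).
Local Notation N := (nplayers g).
Local Notation T := (horizon g).
Local Notation d := (sdim g).
Local Notation Pg := (Pr g).
Implicit Types K : policy g.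

Lemma L2_x0 : L2vec Pg (rvec (x0 g)).
Proof. by move=> i; apply: gaussian_Lfun2; exact: x0_gaussian. Qed.

Lemma L2_noise t : (t < T)%N -> L2vec Pg (rvec (noise g t)).
Proof. by move=> tT i; apply: gaussian_Lfun2; exact: noise_gaussian. Qed.

Lemma cross_noise_x0 t : (t < T)%N -> cross Pg (rvec (noise g t)) (rvec (x0 g)) = 0.
Proof.
move=> tT; apply: cross_independent; [|exact: L2_noise|exact: L2_x0|exact: noise_mean0].
move=> A B mA mB.
exact: (mutually_independent_pair (i := Some (Ordinal tT)) (j := None) (@x0_noise_independent _ g)).
Qed.

Lemma cross_noise s t : (s < T)%N -> (t < T)%N -> s != t ->
  cross Pg (rvec (noise g s)) (rvec (noise g t)) = 0.
Proof.
move=> sT tT st; apply: cross_independent; [|exact: L2_noise|exact: L2_noise|exact: noise_mean0].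
move=> A B mA mB.
exact: (mutually_independent_pair (i := Some (Ordinal sT)) (j := Some (Ordinal tT)) (@x0_noise_independent _ g)).
Qed.

Lemma second_moment_noise t : (t < T)%N -> second_moment Pg (rvec (noise g t)) = W g.
Proof.
move=> tT; have T0 : (0 < T)%N := horizon_gt0 g.
apply: same_law_second_moment; [exact: L2_noise|exact: L2_noise|exact: noise_same_law].
Qed.

Lemma state_step K t :
  state K t.+1 = (fun w => closed_loop K t *m state K t w + rvec (noise g t) w).
Proof.
apply/funext => w /=; congr (_ + _); rewrite /closed_loop mulmxBl mulmx_suml -sumrN.
by congr (_ + _); apply: eq_bigr => i _; rewrite mulmxN mulmxA.
Qed.

Lemma state_L2 K t : (t <= T)%N -> L2vec Pg (state K t).
Proof.
elim: t => [_|t IH tT]; first exact: L2_x0.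
rewrite state_step; apply: L2vec_affine; [exact: IH (ltnW tT)|exact: L2_noise].
Qed.

(** The state at time [t] is affine in the initial state and the noise before
    [t], all independent of the centered noise at time [s >= t]. *)
Lemma cross_noise_state K s t : (t <= s)%N -> (s < T)%N ->
  cross Pg (rvec (noise g s)) (state K t) = 0.
Proof.
elim: t => [_|t IH ts] sT; first exact: cross_noise_x0.
have tT := ltn_trans ts sT.
have xs : cross Pg (state K t) (rvec (noise g s)) = 0.
  by rewrite cross_tr (IH (ltnW ts) sT) trmx0.
have ws : cross Pg (rvec (noise g t)) (rvec (noise g s)) = 0.
  have ne : t != s by rewrite neq_ltn ts.
  exact: cross_noise tT sT ne.
rewrite cross_tr state_step cross_affine.
- by rewrite xs ws mulmx0 addr0 trmx0.
- exact: state_L2 (ltnW tT).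
- exact: L2_noise.
- exact: L2_noise.
Qed.

Lemma Sigma_tE K t : (t <= T)%N ->
  Sigma_t K t = cov (Sigma0 g) (W g) (closed_loop K) t.
Proof.
elim: t => [//|t IH tT]; rewrite /Sigma_t state_step second_moment_affine.
- by rewrite second_moment_noise //= -IH // ltnW.
- exact: state_L2 (ltnW tT).
- exact: L2_noise.
- exact: cross_noise_state.
Qed.

Lemma costE i K : cost i K = traj_cost T (Sigma0 g) (W g) (closed_loop K)
  (fun t => gQ g i t + (K i t)^T *m gR g i t *m K i t) (gQ g i T).
Proof.
rewrite /cost /traj_cost.
have run t : (t <= T)%N ->
  let S w := \sum_(s < t) (quad (gQ g i s) (state K s w)
     + quad (gR g i s) (K i s *m state K s w)) in
  S \in Lfun Pg 1 /\ 'E_Pg[S]%E =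
   (\sum_(s < t) \tr ((gQ g i s + (K i s)^T *m gR g i s *m K i s) *m
      cov (Sigma0 g) (W g) (closed_loop K) s))%:E.
  elim: t => [_|t IH tT] S.
    rewrite /S; under eq_fun do rewrite big_ord0; rewrite big_ord0.
    by split; [exact: Lfun_cst|exact: expectation_cst].
  have [IH1 IH2] := IH (ltnW tT).
  have [q1 q2] := expectation_quad (gQ g i t + (K i t)^T *m gR g i t *m K i t) (state_L2 K (ltnW tT)).
  set S' := (fun w => _) in IH1 IH2.
  have -> : S = S' \+ (fun w => quad (gQ g i t + (K i t)^T *m gR g i t *m K i t) (state K t w)).
    by apply/funext => w; rewrite /S big_ord_recr /= quadD quad_congr.
  split; last by rewrite expectationD // IH2 q2 big_ord_recr EFinD /= -Sigma_tE // ltnW.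
  have := (Lfun_submod_closed Pg (lexx 1%E)).2 1 _ _ IH1 q1.
  by rewrite scale1r.
have [r1 r2] := run _ (leqnn T).
have [q1 q2] := expectation_quad (gQ g i T) (state_L2 K (leqnn T)).
by rewrite expectationD // r2 q2 -Sigma_tE.
Qed.

End GameProcess.

(** * Each player as a single agent *)

Section Players.
Context {R : realType} (g : lq_game R).
Local Notation N := (nplayers g).
Local Notation T := (horizon g).
Local Notation d := (sdim g).
Implicit Types (K L : policy g) (i : 'I_N).

(** The state matrix that player [i] faces when the others use [K]. *)
Definition drift K i t : 'M[R]_d := gA g t - \sum_(j | j != i) gB g j t *m K j t.

Definition player_cost K i (M : nat -> 'M[R]_(cdim i, d)) : R :=
  lqcost T (Sigma0 g) (W g) (drift K i) (gB g i) (gR g i) (gQ g i) M.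

Lemma closed_loopE K i : closed_loop K = loop (drift K i) (gB g i) (K i).
Proof.
apply/funext => t; rewrite /closed_loop /loop /drift (bigD1 i) //= opprD.
by rewrite addrA addrAC.
Qed.

Lemma cost_player_cost K i : cost i K = player_cost K (K i).
Proof. by rewrite costE (closed_loopE K i). Qed.

Lemma drift_ext K L i : (forall j, j != i -> K j = L j) -> drift K i = drift L i.
Proof.
move=> KL; apply/funext => t; rewrite /drift; congr (_ - _).
by apply: eq_bigr => j ji; rewrite KL.
Qed.

Lemma unilateral_in K L i : unilateral i K L i = K i.
Proof. by rewrite /unilateral dfwithin. Qed.

Lemma unilateral_out K L i j : j != i -> unilateral i K L j = L j.
Proof. by move=> ji; rewrite /unilateral dfwithout // eq_sym. Qed.

Lemma cost_unilateral K L i : cost i (unilateral i K L) = player_cost L (K i).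
Proof.
rewrite cost_player_cost unilateral_in /player_cost (@drift_ext _ L) // => j.
exact: unilateral_out.
Qed.

Lemma gap_player_cost K L i : gap i K L = player_cost L (K i) - player_cost L (L i).
Proof. by rewrite /gap cost_unilateral cost_player_cost. Qed.

End Players.

Arguments player_cost {R g} K {i} M.

Lemma tr_delta_mul (R : realType) m n (a : 'I_m) (b : 'I_n) (X : 'M[R]_(m, n)) :
  \tr ((delta_mx a b)^T *m X) = X a b.
Proof.
rewrite trmx_delta -(mul_delta_mx (0 : 'I_1)) -mulmxA mxtrace_mulC -rowE -colE.
by rewrite [LHS]big_ord1 !mxE.
Qed.

Section Regular.
Context {R : realType} (g : lq_game R).
Local Notation N := (nplayers g).
Local Notation T := (horizon g).
Local Notation d := (sdim g).
Local Notation sX := (sigma_X g).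
Local Notation sR := (sigma_R g).
Local Notation sQ := (sigma_Q g).
Implicit Types (K L : policy g) (i : 'I_N).
Hypothesis hQ : forall i t, (t <= T)%N -> sym_posdef (gQ g i t).
Hypothesis hR : forall i t, (t < T)%N -> sym_posdef (gR g i t).
Hypothesis h0 : sym_posdef (Sigma0 g).
Hypothesis hW : sym_posdef (W g).

Let i0 : 'I_N := Ordinal (nplayers_gt0 g).
Let t0 : 'I_T := Ordinal (horizon_gt0 g).

Lemma sigma_X_gt0 : 0 < sX.
Proof.
rewrite lt_min; apply/andP.
by split; [case: (sigma_minP (sdim_gt0 g) h0)|case: (sigma_minP (sdim_gt0 g) hW)].
Qed.

Lemma Sigma0_sub : psd (Sigma0 g - sX%:M).
Proof.
apply: psd_shift => [|x]; first by case: h0.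
apply: le_trans ((sigma_minP (sdim_gt0 g) h0).2 x).
by apply: ler_wpM2r; [exact: dotxx_ge0|rewrite ge_min lexx].
Qed.

Lemma W_sub : psd (W g - sX%:M).
Proof.
apply: psd_shift => [|x]; first by case: hW.
apply: le_trans ((sigma_minP (sdim_gt0 g) hW).2 x).
by apply: ler_wpM2r; [exact: dotxx_ge0|rewrite ge_min lexx orbT].
Qed.

Lemma sigma_R_gt0 : 0 < sR.
Proof.
rewrite /sigma_R; have [p [-> _]] := fminP (i0, t0) (fun p => sigma_min (gR g p.1 p.2)).
by case: (sigma_minP (cdim_gt0 p.1) (hR p.1 (ltn_ord p.2))).
Qed.

Lemma gR_sub i t : (t < T)%N -> psd (gR g i t - sR%:M).
Proof.
move=> tT; have pR := hR i tT; apply: psd_shift => [|x]; first by case: pR.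
apply: le_trans ((sigma_minP (cdim_gt0 i) pR).2 x).
rewrite ler_wpM2r ?dotxx_ge0 //.
exact: (fmin_le (i0, t0) (fun p => sigma_min (gR g p.1 p.2)) (i, Ordinal tT)).
Qed.

Lemma sigma_Q_gt0 : 0 < sQ.
Proof.
rewrite /sigma_Q; have [p [-> _]] := fminP (i0, (ord0 : 'I_T.+1)) (fun p => sigma_min (gQ g p.1 p.2)).
by case: (sigma_minP (sdim_gt0 g) (hQ p.1 (ltn_ord p.2 : (p.2 <= T)%N))).
Qed.

Lemma gQ_sub i t : (t <= T)%N -> psd (gQ g i t - sQ%:M).
Proof.
move=> tT; have pQ := hQ i tT; apply: psd_shift => [|x]; first by case: pQ.
apply: le_trans ((sigma_minP (sdim_gt0 g) pQ).2 x).
rewrite ler_wpM2r ?dotxx_ge0 //.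
exact: (fmin_le (i0, (ord0 : 'I_T.+1)) (fun p => sigma_min (gQ g p.1 p.2)) (i, Ordinal (tT : (t < T.+1)%N))).
Qed.

Lemma game_regular i : regular T (Sigma0 g) (W g) (gR g i) (gQ g i) sX sR sQ.
Proof.
split; [exact: sigma_X_gt0|exact: sigma_R_gt0|exact: sigma_Q_gt0|exact: Sigma0_sub
  |exact: W_sub|exact: gR_sub|exact: gQ_sub].
Qed.

Let sX0 := sigma_X_gt0.

Local Notation E K i := (natgrad T (drift K i) (gB g i) (gR g i) (gQ g i) (K i)).

Lemma Sigma_t_sub K t : (t <= T)%N -> psd (Sigma_t K t - sX%:M).
Proof.
move=> tT; rewrite Sigma_tE //.
apply: cov_sub; [| | exact: Sigma0_sub|exact: W_sub]; exact: sym_posdef_psd.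
Qed.

Lemma Sigma_t_unit K t : (t <= T)%N -> Sigma_t K t \in unitmx.
Proof.
move=> tT; apply: sym_posdef_unit; have pS := Sigma_t_sub K tT.
split; first by case: (psd_of_sub (ltW sX0) pS).
move=> x x0; have := pS.2 x; rewrite quadD quadN quad_scalar subr_ge0.
by apply: lt_le_trans; rewrite mulr_gt0 // dotxx_gt0.
Qed.

Lemma set_gain_in K i t (M : 'M[R]_(cdim i, d)) :
  set_gain K t M i = @dfwith _ (fun _ : nat => 'M[R]_(cdim i, d)) (K i) t M.
Proof. by rewrite /set_gain dfwithin. Qed.

(** Along each line of gains at time [t] the exact cost difference is a
    quadratic polynomial: the second moments up to time [t] and the costs-to-go
    after time [t] do not depend on that gain. *)
Lemma gradE K i t : (t < T)%N -> grad i t K = 2 *: (E K i t *m Sigma_t K t).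
Proof.
move=> tT; apply/matrixP => a b; rewrite /grad mxE.
set D : 'M[R]_(cdim i, d) := delta_mx a b.
pose Kt (M : 'M[R]_(cdim i, d)) := @dfwith _ (fun _ : nat => 'M[R]_(cdim i, d)) (K i) t M.
have costKt M : cost i (set_gain K t M) = player_cost K (Kt M).
  rewrite cost_player_cost set_gain_in /player_cost (@drift_ext _ _ _ K) // => j ji.
  by rewrite /set_gain dfwithout // eq_sym.
have KtKt : Kt (K i t) = K i.
  apply/funext => s; rewrite /Kt; have [->|st] := eqVneq s t; first by rewrite dfwithin.
  by rewrite dfwithout // eq_sym.
set G := curvature T (drift K i) (gB g i) (gR g i) (gQ g i) (K i) t.
set S := Sigma_t K t.
have Ss : S^T = S by case: (psd_of_sub (ltW sX0) (Sigma_t_sub K (ltnW tT))).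
have diff M : player_cost K (Kt M) = player_cost K (K i) +
    \tr (((M - K i t)^T *m G *m (M - K i t) + (M - K i t)^T *m E K i t
      + (E K i t)^T *m (M - K i t)) *m S).
  rewrite /player_cost (lqcost_diff (game_regular i) (K i)).
  congr (_ + _); rewrite (bigD1 (Ordinal tT)) //= big1 => [|s st].
    rewrite addr0 /Kt dfwithin /S Sigma_tE ?(ltnW tT) // (closed_loopE K i).
    suff -> : cov (Sigma0 g) (W g) (loop (drift K i) (gB g i) (Kt M)) t =
      cov (Sigma0 g) (W g) (loop (drift K i) (gB g i) (K i)) t by [].
    have ext s : (s <= t)%N -> cov (Sigma0 g) (W g) (loop (drift K i) (gB g i) (Kt M)) s =
        cov (Sigma0 g) (W g) (loop (drift K i) (gB g i) (K i)) s.
      elim: s => [//|s IH st]; rewrite /= (IH (ltnW st)) /loop /Kt dfwithout //.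
      by rewrite gt_eqF.
    exact: ext.
  have -> : Kt M s = K i s by rewrite /Kt dfwithout // eq_sym.
  by rewrite subrr trmx0 mulmx0 !mul0mx !mulmx0 !addr0 mul0mx mxtrace0.
rewrite (@derive_quadratic _ _ _ _ _ (2 * (E K i t *m S) a b) (\tr (D^T *m G *m D *m S))).
  by rewrite [RHS]mxE.
have c1 : \tr (D^T *m E K i t *m S) = (E K i t *m S) a b.
  by rewrite -mulmxA tr_delta_mul.
have c2 : \tr ((E K i t)^T *m D *m S) = (E K i t *m S) a b.
  by rewrite -c1 -mxtrace_tr !trmx_mul trmxK Ss mxtrace_mulC.
move=> h; rewrite !costKt KtKt diff addrK !(linearZ, trace_mulDl) /=.
rewrite -!scalemxAl !mxtraceZ c1 c2; ring.
Qed.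

Lemma npgE eta K0 m i t : (t < T)%N ->
  npg eta K0 m.+1 i t =
  npg eta K0 m i t - (2 * eta) *: E (npg eta K0 m) i t.
Proof.
move=> tT; rewrite [LHS]/=; move: (npg eta K0 m) => K.
by rewrite (gradE K i tT) -scalemxAl (mulmxK (Sigma_t_unit K (ltnW tT))) scalerA (mulrC eta).
Qed.

Variable Kstar : policy g.
Hypothesis nash : nash_solution Kstar.

Local Notation Es := (fun i M => natgrad T (drift Kstar i) (gB g i) (gR g i) (gQ g i) M).

(** The equation for [K_t] is [curvature * K_t = B^T P drift], that is
    [R K_t = B^T P (drift - B K_t)]. *)
Lemma nash_natgrad0 i t : (t < T)%N -> Es i (Kstar i) t = 0.
Proof.
move=> tT; have [P /(_ i)[eqs PT]] := nash.
have PE s : (s <= T)%N -> P i s = cost_to_go T (drift Kstar i) (gB g i) (gR g i) (gQ g i) (Kstar i) s.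
  apply: value_unique => // r rT; rewrite -closed_loopE; exact: (eqs r rT).2.
have [KE _] := eqs t tT; rewrite /natgrad /loop.
rewrite PE // in KE; move: KE; rewrite -/(drift Kstar i t).
set X := cost_to_go _ _ _ _ _ _ _.
have pG : psd (gR g i t + (gB g i t)^T *m X *m gB g i t - sR%:M).
  exact: (curvature_sub (game_regular i) (Kstar i) tT).
have uG : gR g i t + (gB g i t)^T *m X *m gB g i t \in unitmx.
  apply: sym_posdef_unit; split; first by case: (psd_of_sub (ltW sigma_R_gt0) pG).
  move=> x x0; have := pG.2 x; rewrite quadD quadN quad_scalar subr_ge0.
  by apply: lt_le_trans; rewrite mulr_gt0 ?sigma_R_gt0 // dotxx_gt0.
move=> KE; rewrite mulmxBr opprB addrA mulmxA -mulmxDl {1}KE !mulmxA.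
by rewrite mulmxV // mul1mx subrr.
Qed.

(** This turns the gaps into a distance to the equilibrium. *)
Lemma gap_ge K i :
  sX * sR * (\sum_(t < T) frob2 (K i t - Kstar i t)) <= gap i K Kstar.
Proof.
rewrite gap_player_cost mulrC (mulrC sX) [leLHS]mulrC.
exact: (gap_lower (game_regular i) (K i) (fun t => @nash_natgrad0 i t)).
Qed.

Lemma player_cost_ge K i (M : nat -> 'M[R]_(cdim i, d)) : sQ * sX <= player_cost K M.
Proof. exact: (lqcost_ge (game_regular i) _ (sdim_gt0 g)). Qed.

Lemma gap_ge0 K i : 0 <= gap i K Kstar.
Proof.
apply: le_trans (gap_ge K i); rewrite !mulr_ge0 ?(ltW sX0) ?(ltW sigma_R_gt0) //.
by apply: sumr_ge0 => t _; exact: frob2_ge0.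
Qed.

End Regular.

Arguments npgE {R g} _ _ _ _ eta K0 m i {t}.

(** * One step of the natural policy gradient method *)

Section Step.
Context {R : realType} (g : lq_game R).
Local Notation N := (nplayers g).
Local Notation T := (horizon g).
Local Notation d := (sdim g).
Local Notation sX := (sigma_X g).
Local Notation sR := (sigma_R g).
Local Notation sQ := (sigma_Q g).
Local Notation gaB := (gamma_B g).
Local Notation gaR := (gamma_R g).
Implicit Types (i j : 'I_N).
Hypothesis hQ : forall i t, (t <= T)%N -> sym_posdef (gQ g i t).
Hypothesis hR : forall i t, (t < T)%N -> sym_posdef (gR g i t).
Hypothesis h0 : sym_posdef (Sigma0 g).
Hypothesis hW : sym_posdef (W g).
Variable Kstar : policy g.
Hypothesis nash : nash_solution Kstar.
(** [psi] bounds the gaps, [Cm] the costs against the equilibrium, [rs] the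
    closed loop at the equilibrium and [rho] all closed loops that occur. *)
Variables (psi Cm rs rho eta : R).
Hypothesis psi0 : 0 <= psi.
Hypothesis hC : forall i, cost i Kstar + psi <= Cm.
Hypothesis rsP : forall t, (t < T)%N -> opbound (closed_loop Kstar t) rs.
Hypothesis rhoP : rs + gaB * (N%:R * Num.sqrt (psi / (sX * sR))) <= rho.
Hypothesis rho0 : 0 <= rho.
Hypothesis eta0 : 0 < eta.
Hypothesis etaP : eta * (gaR + gaB ^+ 2 * (Cm / sX)) <= 2^-1.

Let i0 : 'I_N := Ordinal (nplayers_gt0 g).
Let t0 : 'I_T := Ordinal (horizon_gt0 g).
Let reg i := game_regular hQ hR h0 hW i.
Let sX0 : 0 < sX := regular_sX (reg i0).
Let sR0 : 0 < sR := regular_sR (reg i0).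
Let sQ0 : 0 < sQ := regular_sQ (reg i0).
Let geom := geom_sum (rho ^+ 2) T.
Let Snorm := spectral_norm (Sigma Kstar).
(** The rate [a] is the one of a single player; [b] weighs the coupling to the
    other players. *)
Let a := sX * sR / Snorm.
Let b := 5 * gaB ^+ 4 * Cm ^+ 3 * geom ^+ 2 / (sX ^+ 3 * sR * sQ).
Hypothesis bP : b * (N%:R - 1) ^+ 2 <= a / 4.

Lemma gB_opbound i t : (t < T)%N -> opbound (gB g i t) gaB.
Proof.
move=> tT; apply: opbound_le (spectral_normP _) _.
exact: (fmax_ge (i0, t0) (fun p => spectral_norm (gB g p.1 p.2)) (i, Ordinal tT)).
Qed.

Lemma gR_opbound i t : (t < T)%N -> opbound (gR g i t) gaR.
Proof.
move=> tT; apply: opbound_le (spectral_normP _) _.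
exact: (fmax_ge (i0, t0) (fun p => spectral_norm (gR g p.1 p.2)) (i, Ordinal tT)).
Qed.

Lemma gamma_B_ge0 : 0 <= gaB.
Proof.
apply: le_trans (spectral_norm_ge0 (gB g i0 0)) _.
exact: (fmax_ge (i0, t0) (fun p => spectral_norm (gB g p.1 p.2)) (i0, t0)).
Qed.

(** [Sigma] is the sum over time of the psd matrices [Sigma_t]. *)
Lemma Sigma_norm_sub t : (t < T)%N ->
  psd (Snorm%:M - cov (Sigma0 g) (W g) (closed_loop Kstar) t).
Proof.
move=> tT; rewrite -Sigma_tE ?(ltnW tT) //.
have Ss s : (s <= T)%N -> psd (Sigma_t Kstar s).
  by move=> sT; exact: psd_of_sub (ltW sX0) (Sigma_t_sub h0 hW Kstar sT).
split=> [|x]; first by rewrite trmxDE trmxNE tr_scalar_mx (Ss t (ltnW tT)).1.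
rewrite quadD quadN quad_scalar subr_ge0.
apply: le_trans (opbound_quad x (spectral_normP (Sigma Kstar))).
rewrite /Sigma (bigD1 (Ordinal (ltnW tT : (t < T.+1)%N))) //= quadD lerDl.
elim/big_ind: _ => [|X Y X0 Y0|s _].
- by rewrite quadE mul0mx /dot mulmx0 mxE.
- by rewrite quadD addr_ge0.
- by apply: (Ss s _).2; rewrite -ltnS.
Qed.

Lemma scalar_sandwich n (X : 'M[R]_n) (u v : R) : (0 < n)%N ->
  psd (X - u%:M) -> psd (v%:M - X) -> u <= v.
Proof.
move=> n0 [_ uX] [_ Xv]; pose x : 'cV[R]_n := delta_mx (Ordinal n0) 0.
have xx : dot x x = 1 by rewrite dot_delta mxE !eqxx.
have := uX x; have := Xv x; rewrite !(quadD, quadN, quad_scalar) xx; lra.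
Qed.

Lemma Sigma_norm_ge : sX <= Snorm.
Proof.
apply: (scalar_sandwich (sdim_gt0 g) _ (Sigma_norm_sub (horizon_gt0 g))).
by rewrite -Sigma_tE //; apply: Sigma_t_sub.
Qed.

Lemma cost_bound_ge i : sQ * sX <= Cm.
Proof.
apply: le_trans (hC i); rewrite cost_player_cost.
apply: (le_trans (player_cost_ge hQ hR h0 hW Kstar (Kstar i))).
by rewrite lerDl.
Qed.

Section OneStep.
Variables K K' : policy g.
Hypothesis gapK : forall i, gap i K Kstar <= psi.
Hypothesis stepK : forall i t, (t < T)%N -> K' i t =
  K i t - (2 * eta) *: natgrad T (drift K i) (gB g i) (gR g i) (gQ g i) (K i) t.

(** The distance of player [j] from its equilibrium gains. *)
Let e j : R := Num.sqrt (\sum_(t < T) frob2 (K j t - Kstar j t)).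

Let e_ge0 j : 0 <= e j. Proof. exact: sqrtr_ge0. Qed.

Let fsum_ge0 j : 0 <= \sum_(t < T) frob2 (K j t - Kstar j t).
Proof. by apply: sumr_ge0 => t _; exact: frob2_ge0. Qed.

Let e_sq j : e j ^+ 2 <= gap j K Kstar / (sX * sR).
Proof.
rewrite sqr_sqrtr // ler_pdivlMr ?mulr_gt0 // mulrC.
exact: gap_ge.
Qed.

Let e_le j : e j <= Num.sqrt (psi / (sX * sR)).
Proof.
rewrite ler_wsqrtr // -(sqr_sqrtr (fsum_ge0 j)); apply: (le_trans (e_sq j)).
by rewrite ler_pM2r ?invr_gt0 ?mulr_gt0.
Qed.

Let eB j t : (t < T)%N -> opbound (K j t - Kstar j t) (e j).
Proof.
move=> tT; apply: opbound_le (opbound_frob _) _; rewrite ler_wsqrtr //.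
rewrite (bigD1 (Ordinal tT)) //= lerDl; apply: sumr_ge0 => s _; exact: frob2_ge0.
Qed.

Let BdK j t : (t < T)%N -> opbound (gB g j t *m (K j t - Kstar j t)) (gaB * e j).
Proof. by move=> tT; apply: opboundM; [exact: gamma_B_ge0|exact: gB_opbound|exact: eB]. Qed.

Let drift_opbound i t : (t < T)%N ->
  opbound (drift K i t - drift Kstar i t) (gaB * \sum_(j | j != i) e j).
Proof.
move=> tT; have -> : drift K i t - drift Kstar i t =
    - \sum_(j | j != i) gB g j t *m (K j t - Kstar j t).
  rewrite /drift opprB addrC addrA subrK -sumrB -sumrN.
  by apply: eq_bigr => j _; rewrite mulmxBr opprB.
rewrite mulr_sumr; apply/opboundN/opbound_sum => j _; exact: BdK.
Qed.

Let sum_e_le (S : pred 'I_N) :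
  \sum_(j | S j) e j <= N%:R * Num.sqrt (psi / (sX * sR)).
Proof.
apply: (@le_trans _ _ (\sum_j e j)).
  rewrite [leRHS](bigID S) /= lerDl; apply: sumr_ge0 => j _; exact: e_ge0.
apply: (@le_trans _ _ (\sum_(j < N) Num.sqrt (psi / (sX * sR)))).
  by apply: ler_sum => j _; exact: e_le.
by rewrite sumr_const card_ord mulr_natl.
Qed.

Let loopB i t : (t < T)%N -> opbound (loop (drift K i) (gB g i) (K i) t) rho.
Proof.
move=> tT; rewrite -closed_loopE.
have -> : closed_loop K t = closed_loop Kstar t - \sum_j gB g j t *m (K j t - Kstar j t).
  rewrite /closed_loop -addrA -opprD; congr (_ - _); rewrite -big_split /=.
  by apply: eq_bigr => j _; rewrite mulmxBr subrKC.
apply: opbound_le rhoP; apply: (opbound_le (opboundD (rsP tT)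
  (opboundN (opbound_sum (fun j _ => BdK j tT))))).
by rewrite lerD2l -mulr_sumr ler_wpM2l ?gamma_B_ge0 // sum_e_le.
Qed.

Let loopB' i t : (t < T)%N -> opbound (loop (drift Kstar i) (gB g i) (K i) t) rho.
Proof.
move=> tT; have -> : loop (drift Kstar i) (gB g i) (K i) t =
    closed_loop Kstar t - gB g i t *m (K i t - Kstar i t).
  by rewrite (closed_loopE _ i) /loop mulmxBr opprB addrA addrNK.
apply: opbound_le rhoP; apply: (opbound_le (opboundD (rsP tT) (opboundN (BdK i tT)))).
rewrite lerD2l ler_wpM2l ?gamma_B_ge0 //.
have := sum_e_le (pred1 i); rewrite big_pred1_eq; exact.
Qed.

Let pcostK i : player_cost Kstar (K i) <= Cm.
Proof.
apply: le_trans (hC i); have := gapK i.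
by rewrite gap_player_cost -cost_player_cost lerBlDr addrC.
Qed.

Let Cm0 : 0 < Cm.
Proof. by apply: lt_le_trans (cost_bound_ge i0); exact: mulr_gt0. Qed.

Let p := Cm / sX.
Let p0 : 0 < p. Proof. exact: divr_gt0. Qed.

Let ctg_quad i t x : (t <= T)%N ->
  quad (cost_to_go T (drift Kstar i) (gB g i) (gR g i) (gQ g i) (K i) t) x <= p * dot x x.
Proof.
move=> tT; apply: le_trans (cost_to_go_bound (reg i) (K i) x tT) _.
apply: ler_wpM2r; first exact: dotxx_ge0.
rewrite ler_pM2r ?invr_gt0 //; exact: pcostK.
Qed.

Let ctgB i t : (t <= T)%N ->
  opbound (cost_to_go T (drift Kstar i) (gB g i) (gR g i) (gQ g i) (K i) t) p.
Proof.
move=> tT; apply: psd_opbound; [exact: (cost_to_go_psd (reg i))|exact: ltW|].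
by move=> x; exact: ctg_quad.
Qed.

Let curvB i t : (t < T)%N ->
  psd ((gaR + gaB ^+ 2 * p)%:M - curvature T (drift Kstar i) (gB g i) (gR g i) (gQ g i) (K i) t).
Proof.
move=> tT; have [Cs _] := curvature_psd (reg i) (Ah := drift Kstar i) (B := gB g i) (K i) tT.
split=> [|x]; first by rewrite trmxDE trmxNE tr_scalar_mx Cs.
rewrite quadD quadN quad_scalar subr_ge0 /curvature quadD quad_congr mulrDl lerD //.
  by apply: opbound_quad; exact: gR_opbound.
apply: (le_trans (ctg_quad i _ tT)); rewrite -[leRHS]mulrA [leRHS]mulrCA.
rewrite ler_wpM2l ?(ltW p0) // -!l2norm_sq -exprMn.
by rewrite ler_pXn2r ?nnegrE ?mulr_ge0 ?l2norm_ge0 ?gamma_B_ge0 //; exact: gB_opbound.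
Qed.

Let others i := \sum_(j | j != i) gap j K Kstar.

Let card_others i : #|[pred j | j != i]|%:R = N%:R - 1 :> R.
Proof.
have /(congr1 (fun n : nat => n%:R : R)) := cardC (pred1 i).
rewrite card1 card_ord natrD => <-.
by rewrite [1 + _]addrC addrK; congr (_%:R); exact: eq_card.
Qed.

Let N1_ge0 : 0 <= N%:R - 1 :> R.
Proof. by rewrite -(card_others i0). Qed.

Let others_le i : others i <= (N%:R - 1) * psi.
Proof.
rewrite -(card_others i) mulr_natl -sumr_const; apply: ler_sum => j _; exact: gapK.
Qed.

Let eps_sq i : (gaB * \sum_(j | j != i) e j) ^+ 2 <=
  gaB ^+ 2 * ((N%:R - 1) * others i / (sX * sR)).
Proof.
rewrite exprMn ler_wpM2l ?sqr_ge0 // -(card_others i).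
apply: (le_trans (sqr_sum_le _ _)); rewrite -mulrA ler_wpM2l // mulr_suml.
apply: ler_sum => j _; exact: e_sq.
Qed.

(** The bound of [natgrad_perturb] for the error in player [i]'s direction. *)
Let delta i := 2 * gaB * p * (gaB * \sum_(j | j != i) e j) * geom.

Let geom_ge0 : 0 <= geom. Proof. by apply: geom_sum_ge0; exact: sqr_ge0. Qed.

Let sum_e_ge0 i : 0 <= \sum_(j | j != i) e j.
Proof. by apply: sumr_ge0 => j _; exact: e_ge0. Qed.

Let delta_ge0 i : 0 <= delta i.
Proof.
have B0 := gamma_B_ge0; have s0 := sum_e_ge0 i; have q0 := ltW p0; have g0 := geom_ge0.
rewrite /delta; apply: mulr_ge0 => //; apply: mulr_ge0; last exact: mulr_ge0.
by apply: mulr_ge0 => //; exact: mulr_ge0.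
Qed.

Let delta_sq i : delta i ^+ 2 * (5 / 4 * Cm) / sQ <= b * (N%:R - 1) * others i.
Proof.
have -> : b * (N%:R - 1) * others i =
   (2 * gaB * p * geom) ^+ 2 * (5 / 4 * Cm) / sQ *
   (gaB ^+ 2 * ((N%:R - 1) * others i / (sX * sR))).
  by rewrite /b /p; field; rewrite !gt_eqF.
have -> : delta i ^+ 2 * (5 / 4 * Cm) / sQ =
   (2 * gaB * p * geom) ^+ 2 * (5 / 4 * Cm) / sQ * (gaB * \sum_(j | j != i) e j) ^+ 2.
  by rewrite /delta; ring.
apply: ler_wpM2l; last exact: eps_sq.
apply: divr_ge0; last exact: ltW.
by apply: mulr_ge0; [exact: sqr_ge0|apply: mulr_ge0 => //; exact: ltW].
Qed.

Let b_ge0 : 0 <= b.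
Proof.
have B0 := gamma_B_ge0; have C0 := ltW Cm0; have X0 := ltW sX0; have R0 := ltW sR0; have Q0 := ltW sQ0.
apply: divr_ge0; last by rewrite !mulr_ge0 ?exprn_ge0.
by apply: mulr_ge0; [rewrite !mulr_ge0 ?exprn_ge0|exact: sqr_ge0].
Qed.

Let Snorm0 : 0 < Snorm. Proof. exact: lt_le_trans sX0 Sigma_norm_ge. Qed.

Let a_ge0 : 0 <= a.
Proof. by rewrite divr_ge0 ?mulr_ge0 ?(ltW sX0) ?(ltW sR0) ?(ltW Snorm0). Qed.

Let a_le : a <= sR.
Proof. by rewrite ler_pdivrMr // mulrC ler_pM2l // Sigma_norm_ge. Qed.

Let eta_sR : eta * sR <= 2^-1.
Proof.
apply: le_trans etaP; rewrite ler_pM2l //.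
exact: (scalar_sandwich (cdim_gt0 i0) (curvature_sub (reg i0) (K i0) (horizon_gt0 g)) (curvB i0 (horizon_gt0 g))).
Qed.

Let psi_Cm : psi <= Cm.
Proof.
apply: le_trans (hC i0); rewrite lerDr cost_player_cost.
by apply: le_trans (player_cost_ge hQ hR h0 hW Kstar (Kstar i0)); rewrite mulr_ge0 ?ltW.
Qed.

(** From [b (N - 1)^2 <= a / 4 <= sR / 4] and [psi <= Cm] one gets
    [5 delta^2 <= sR sQ], and [eta sR <= 1/2] because [sR] is below the curvature
    bound. *)
Let delta_small i : 5 * (2 * eta * delta i ^+ 2) <= sQ.
Proof.
have h1 : b * (N%:R - 1) * others i <= a / 4 * Cm.
  apply: (@le_trans _ _ (b * (N%:R - 1) ^+ 2 * psi)).
    rewrite expr2 mulrA -[leRHS]mulrA.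
    by apply: ler_wpM2l; [exact: mulr_ge0|exact: others_le].
  by apply: ler_pM => //; rewrite mulr_ge0 ?sqr_ge0.
have h2 := le_trans (delta_sq i) h1.
have h3 : delta i ^+ 2 * 5 <= sR * sQ.
  have : delta i ^+ 2 * (5 / 4 * Cm) <= a / 4 * Cm * sQ by rewrite -ler_pdivrMr.
  have -> : delta i ^+ 2 * (5 / 4 * Cm) = delta i ^+ 2 * 5 * (Cm / 4) by ring.
  have -> : a / 4 * Cm * sQ = a * sQ * (Cm / 4) by ring.
  rewrite ler_pM2r ?divr_gt0 // => h; apply: (le_trans h).
  by rewrite ler_pM2r.
have h4 := ler_wpM2l (ltW eta0) h3; have h5 := ler_wpM2r (ltW sQ0) eta_sR; lra.
Qed.

Lemma one_step i : gap i K' Kstar <=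
  (1 - 2 * eta * a) * gap i K Kstar + 2 * eta * (b * (N%:R - 1) * others i).
Proof.
pose D t := natgrad T (drift K i) (gB g i) (gR g i) (gQ g i) (K i) t -
            natgrad T (drift Kstar i) (gB g i) (gR g i) (gQ g i) (K i) t.
have DB t : (t < T)%N -> opbound (D t) (delta i).
  move=> tT.
  exact: (natgrad_perturb rho0 (ltW p0) (mulr_ge0 gamma_B_ge0 (sum_e_ge0 i)) gamma_B_ge0
    (@loopB i) (@loopB' i) (@drift_opbound i) (@ctgB i) (@gB_opbound i) tT).
have Ss t : (t < T)%N -> psd (Snorm%:M - cov (Sigma0 g) (W g) (loop (drift Kstar i) (gB g i) (Kstar i)) t).
  by move=> tT; rewrite -closed_loopE; exact: Sigma_norm_sub.
have K'E t : (t < T)%N -> K' i t = K i t - (2 * eta) *: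
    (natgrad T (drift Kstar i) (gB g i) (gR g i) (gQ g i) (K i) t + D t).
  by move=> tT; rewrite stepK // /D subrKC.
have := contraction_step (reg i) eta0 etaP (delta_ge0 i) Snorm0 (@curvB i) Ss DB K'E (delta_small i).
rewrite -/(player_cost Kstar (K' i)) -/(player_cost Kstar (Kstar i)) -/(player_cost Kstar (K i)) -!gap_player_cost -/a.
move=> H; apply: (le_trans H); rewrite lerD2l ler_pM2l ?mulr_gt0 //.
apply: le_trans (delta_sq i); rewrite ler_pM2r ?invr_gt0 //.
by rewrite ler_wpM2l ?sqr_ge0 // ler_pM2l // pcostK.
Qed.

(** The largest gap does not grow, because the other gaps weigh at most
    [b (N - 1)^2 < a] in total.  Individual gaps have to be controlled, besides
    their sum, since the bound on the cost of a player involves its own gap. *)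
Lemma one_step_le_psi i : gap i K' Kstar <= psi.
Proof.
have ga : 0 <= 1 - 2 * eta * a by have := ler_wpM2l (ltW eta0) a_le; have := eta_sR; lra.
have h1 := ler_wpM2l ga (gapK i).
have h2 : b * (N%:R - 1) * others i <= a / 4 * psi.
  apply: (@le_trans _ _ (b * (N%:R - 1) ^+ 2 * psi)); last exact: ler_wpM2r.
  rewrite expr2 mulrA -[leRHS]mulrA.
  by apply: ler_wpM2l; [exact: mulr_ge0|exact: others_le].
have h3 := ler_wpM2l (ltW eta0) h2; have h4 := one_step i.
have h5 : 0 <= eta * (a * psi) by apply: mulr_ge0; [exact: ltW|exact: mulr_ge0].
lra.
Qed.

(** Each gap occurs in the sums of the [N - 1] other players. *)
Lemma one_step_sum : \sum_i gap i K' Kstar <=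
  (1 - 2 * eta * (a - b * (N%:R - 1) ^+ 2)) * \sum_i gap i K Kstar.
Proof.
apply: (@le_trans _ _ (\sum_i ((1 - 2 * eta * a) * gap i K Kstar
  + 2 * eta * (b * (N%:R - 1) * others i)))).
  by apply: ler_sum => i _; exact: one_step.
rewrite big_split /= -!mulr_sumr.
have -> : \sum_i others i = (N%:R - 1) * \sum_i gap i K Kstar.
  rewrite /others (exchange_big_dep xpredT) //= mulr_sumr; apply: eq_bigr => j _.
  rewrite -(card_others j) mulr_natl -sumr_const.
  by apply: eq_bigl => i; rewrite inE eq_sym.
rewrite le_eqVlt; apply/orP; left; apply/eqP; ring.
Qed.

End OneStep.
End Step.

(** * Convergence *)

(** The monomial [z * sX * (sX + 1)^-1 * (gamma_R + 1)^-1 * (gamma_B + 1)^-2 *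
    (N + 1)^-3].  The positions are those of the variables in [model_params],
    shifted by one for [z]; the factor [(N + 1)^-3] stands for the constant
    [1/8]. *)
Definition step_size_poly (R : realType) : mpoly.mpoly 18 R :=
  mpoly.mpolyX R (mpoly.Multinom [tuple nth 0%N [:: 1; 0; 0; 0; 3; 0; 0; 0; 0; 2; 1; 1; 1]%N i | i < 18]).

Lemma eval_step_size (R : realType) (g : lq_game R) (K : policy g) (z : R) :
  eval_H (step_size_poly R) z K =
  z * ((nplayers g)%:R + 1)^-1 ^+ 3 * (gamma_B g + 1)^-1 ^+ 2 * (gamma_R g + 1)^-1 *
    (sigma_X g + 1)^-1 * sigma_X g.
Proof.
rewrite /eval_H /step_size_poly mpoly.mevalX.
under eq_bigr do rewrite mpoly.mnmE.
rewrite !big_ord_recl big_ord0 /= !expr0 !expr1 !mul1r !mulr1 !mulrA //.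
Qed.

(** [gR + gB^2 * (C / sX)] bounds the curvature when [C] bounds the costs. *)
Lemma step_size_small (R : realType) (n S C gB gR sX eta : R) :
  1 <= n -> 0 <= S -> 0 <= C -> C <= 2 * S -> 0 <= gB -> 0 <= gR -> 0 < sX -> 0 < eta ->
  eta < (S + 1)^-1 * (n + 1)^-1 ^+ 3 * (gB + 1)^-1 ^+ 2 * (gR + 1)^-1 * (sX + 1)^-1 * sX ->
  eta * (gR + gB ^+ 2 * (C / sX)) <= 2^-1.
Proof.
move=> n1 S0 C0 C_le B0 R0 X0 e0 eP.
set D := (S + 1) * (gB + 1) ^+ 2 * (gR + 1) * (sX + 1).
have D0 : 0 < D by rewrite /D !mulr_gt0 ?exprn_gt0 //; lra.
have n8 : (n + 1)^-1 ^+ 3 <= 8^-1.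
  have n2 : (n + 1)^-1 <= 2^-1 by rewrite lef_pV2 ?posrE; lra.
  have := @lerXn2r R 3 _ _ _ _ n2; rewrite !nnegrE => /(_ _ _) H.
  apply: le_trans (H _ _) _; rewrite ?invr_ge0 //; first lra.
  by rewrite !exprS expr0; lra.
have eD : eta * D <= sX / 8.
  apply: (@le_trans _ _ ((n + 1)^-1 ^+ 3 * sX)); last first.
    by rewrite mulrC ler_pM2l.
  rewrite -ler_pdivlMr // ltW //; apply: (lt_le_trans eP).
  rewrite le_eqVlt; apply/orP; left; apply/eqP; rewrite /D; field.
  by rewrite !gt_eqF //; lra.
have sum3 : gR * sX + gB ^+ 2 * C <= 3 * D.
  have h1 : gR * sX <= D.
    rewrite /D; set u := (S + 1) * (gB + 1) ^+ 2.
    have u1 : 1 <= u by rewrite /u expr2; nra.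
    have v0 : 0 <= (gR + 1) * (sX + 1) by rewrite mulr_ge0; lra.
    rewrite -mulrA; have := ler_wpM2r v0 u1; nra.
  have h2 : gB ^+ 2 * C <= 2 * D.
    apply: (@le_trans _ _ ((gB + 1) ^+ 2 * (2 * (S + 1)))).
      by apply: ler_pM => //; [exact: sqr_ge0| rewrite !expr2; nra|lra].
    have -> : D = (S + 1) * (gB + 1) ^+ 2 * ((gR + 1) * (sX + 1)) by rewrite /D; ring.
    have u0 : 0 <= (S + 1) * (gB + 1) ^+ 2 by rewrite mulr_ge0 ?sqr_ge0 //; lra.
    have v1 : 1 <= (gR + 1) * (sX + 1) by nra.
    have := ler_wpM2l u0 v1; lra.
  lra.
have -> : gR + gB ^+ 2 * (C / sX) = (gR * sX + gB ^+ 2 * C) / sX by field; rewrite gt_eqF.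
rewrite mulrA ler_pdivrMr //; have := ler_wpM2l (ltW e0) sum3; lra.
Qed.

Theorem theorem3p5 (R : realType) (delta : R) (delta_gt0 : 0 < delta) :
  exists h : mpoly.mpoly 18 R,
  forall (g : lq_game R) (Kstar K0 : policy g),
  let N : R := (nplayers g)%:R in
  let T : R := (horizon g)%:R in
  let d : R := (sdim g)%:R in
  let sX := sigma_X g in
  let sR := sigma_R g in
  let sQ := sigma_Q g in
  let rho := rho_bar delta K0 Kstar in
  let geom := (rho ^+ (2 * horizon g) - 1) / (rho ^+ 2 - 1) in
  let Cmax := max_cost Kstar + psi K0 Kstar in
  let alpha :=
    sX * sR / spectral_norm (Sigma Kstar)
    - 20 * (N - 1) ^+ 2 * T ^+ 2 * d
      * (gamma_B g ^+ 4 * Cmax ^+ 4 / (sX ^+ 4 * sQ ^+ 2 * sR)) * geom ^+ 2 in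
  (forall i t, (t <= horizon g)%N -> sym_posdef (gQ g i t)) ->
  (forall i t, (t < horizon g)%N -> sym_posdef (gR g i t)) ->
  sym_posdef (Sigma0 g) ->
  sym_posdef (W g) ->
  unique_nash_solution Kstar ->
  sX ^+ 5 / spectral_norm (Sigma Kstar)
    > 20 * (N - 1) ^+ 2 * T ^+ 2 * d
      * (gamma_B g ^+ 4 * Cmax ^+ 4 / (sQ ^+ 2 * sR ^+ 2)) * geom ^+ 2 ->
  0 < alpha /\
  exists eta0 : R,
  eta0 = eval_H h ((\sum_i cost i (unilateral i K0 Kstar)) + 1)^-1 Kstar /\
  0 < eta0 /\
  forall eps eta : R, 0 < eps -> 0 < eta -> eta < eta0 ->
  forall M : nat,
    1 / (alpha * eta) * ln ((\sum_i gap i K0 Kstar) / eps) <= M%:R ->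
    \sum_i gap i (npg eta K0 M) Kstar <= eps.
Proof.
exists (step_size_poly R) => g Kstar K0 N T d sX sR sQ rho geom Cmax alpha.
move=> hQ hR h0 hW [nash _] cond.
pose i0 : 'I_(nplayers g) := Ordinal (nplayers_gt0 g).
pose t0 : 'I_(horizon g) := Ordinal (horizon_gt0 g).
have sX0 : 0 < sX by exact: sigma_X_gt0.
have sR0 : 0 < sR by exact: sigma_R_gt0.
have sQ0 : 0 < sQ by exact: sigma_Q_gt0.
pose Sn := spectral_norm (Sigma Kstar).
have Sn_ge : sX <= Sn by exact: Sigma_norm_ge.
have Sn0 : 0 < Sn by exact: lt_le_trans Sn_ge.
have gB0 : 0 <= gamma_B g by exact: gamma_B_ge0.
have gR0 : 0 <= gamma_R g.
  apply: le_trans (spectral_norm_ge0 (gR g i0 0)) _.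
  exact: (fmax_ge (i0, t0) (fun p => spectral_norm (gR g p.1 p.2)) (i0, t0)).
have N1 : 1 <= N by rewrite ler1n nplayers_gt0.
have T1 : 1 <= T by rewrite ler1n horizon_gt0.
have d1 : 1 <= d by rewrite ler1n sdim_gt0.
have gap0 i : 0 <= gap i K0 Kstar by exact: gap_ge0.
have gap_psi i : gap i K0 Kstar <= psi K0 Kstar.
  exact: (fmax_ge i0 (fun i => gap i K0 Kstar)).
have psi0 : 0 <= psi K0 Kstar by exact: le_trans (gap0 i0) (gap_psi i0).
have cost_C i : cost i Kstar + psi K0 Kstar <= Cmax.
  rewrite lerD2r; exact: (fmax_ge i0 (fun i => cost i Kstar)).
have costs0 (K : policy g) i : 0 <= cost i K.
  rewrite cost_player_cost; apply: le_trans (player_cost_ge hQ hR h0 hW K (K i)).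
  by rewrite mulr_ge0 ?ltW.
have C_ge : sQ * sX <= Cmax by exact: (cost_bound_ge hQ hR h0 hW psi0 cost_C i0).
have QX0 : 0 < sQ * sX by exact: mulr_gt0.
have C0 : 0 < Cmax by exact: lt_le_trans C_ge.
pose rs := rho_star delta Kstar.
have rs1 : 1 < rs by rewrite /rs /rho_star lt_max ltrDl delta_gt0 orbT.
have rsP t : (t < horizon g)%N -> opbound (closed_loop Kstar t) rs.
  move=> tT; apply: opbound_le (spectral_normP _) _; rewrite /rs /rho_star le_max.
  by rewrite (fmax_ge t0 (fun t : 'I_(horizon g) => spectral_norm (closed_loop Kstar t)) (Ordinal tT)).
have inv20 : 0 <= (20 * T ^+ 2)^-1 by rewrite invr_ge0 mulr_ge0 // sqr_ge0.
(* [sqrt (psi / (sX * sR))] bounds the distance of a player to equilibrium, and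
   [1 <= T] compares it with the square root in [rho_bar]. *)
have rhoP : rs + gamma_B g * (N * Num.sqrt (psi K0 Kstar / (sX * sR))) <= rho.
  rewrite /rho /rho_bar -/rs -[leLHS]addr0 lerD // lerD2l mulrCA mulrA.
  apply: ler_wpM2l; first by rewrite mulr_ge0 // ler0n.
  rewrite ler_wsqrtr // -mulrA; apply: ler_peMl => //.
  by apply: divr_ge0 => //; apply: ltW; exact: mulr_gt0.
have rho1 : 1 < rho.
  apply: (lt_le_trans rs1); apply: le_trans rhoP; rewrite lerDl.
  by rewrite !mulr_ge0 ?sqrtr_ge0 ?ler0n.
have rho0 : 0 <= rho by lra.
have geomE : geom = geom_sum (rho ^+ 2) (horizon g).
  by rewrite /geom exprM geom_sumE // gt_eqF // exprn_egt1.
pose a := sX * sR / Sn.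
pose b := 5 * gamma_B g ^+ 4 * Cmax ^+ 3 * geom_sum (rho ^+ 2) (horizon g) ^+ 2 / (sX ^+ 3 * sR * sQ).
pose beta := 20 * (N - 1) ^+ 2 * T ^+ 2 * d
      * (gamma_B g ^+ 4 * Cmax ^+ 4 / (sX ^+ 4 * sQ ^+ 2 * sR)) * geom ^+ 2.
have alphaE : alpha = a - beta by [].
have alpha0 : 0 < alpha.
  have -> : alpha = sR / sX ^+ 4 * (sX ^+ 5 / Sn - 20 * (N - 1) ^+ 2 * T ^+ 2 * d
      * (gamma_B g ^+ 4 * Cmax ^+ 4 / (sQ ^+ 2 * sR ^+ 2)) * geom ^+ 2).
    rewrite alphaE /a /beta; field; rewrite !gt_eqF //.
  by rewrite mulr_gt0 ?divr_gt0 ?exprn_gt0 // subr_gt0.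
have a0 : 0 < a by rewrite divr_gt0 // mulr_gt0.
have b0 : 0 <= b.
  rewrite /b divr_ge0 ?mulr_ge0 ?exprn_ge0 ?geom_sum_ge0 ?sqr_ge0 // ltW //.
have bbeta : b * (N - 1) ^+ 2 <= beta / 4.
  have -> : beta / 4 = b * (N - 1) ^+ 2 * (T ^+ 2 * d * (Cmax / (sQ * sX))).
    by rewrite /beta /b geomE; field; rewrite !gt_eqF.
  apply: ler_peMr; first by rewrite mulr_ge0 // sqr_ge0.
  have c1 : 1 <= Cmax / (sQ * sX) by rewrite ler_pdivlMr // mul1r.
  have T2 : 1 <= T ^+ 2 by rewrite exprn_ege1.
  have Td : 1 <= T ^+ 2 * d by nra.
  nra.
have bP : b * (N - 1) ^+ 2 <= a / 4 by lra.
have bN0 : 0 <= b * (N - 1) ^+ 2 by rewrite mulr_ge0 // sqr_ge0.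
split => //; pose S := \sum_i cost i (unilateral i K0 Kstar).
exists (eval_H (step_size_poly R) (S + 1)^-1 Kstar); split => //.
have S0 : 0 <= S by apply: sumr_ge0 => i _; exact: costs0.
have cost_S i : cost i (unilateral i K0 Kstar) <= S.
  rewrite /S (bigD1 i) //= lerDl; apply: sumr_ge0 => j _; exact: costs0.
have C_le : Cmax <= 2 * S.
  (* The maxima in [Cmax] may be attained by two different players. *)
  rewrite /Cmax /max_cost /psi.
  have [i [-> _]] := fmaxP i0 (fun i => cost i Kstar).
  have [j [-> _]] := fmaxP i0 (fun i => gap i K0 Kstar).
  have := cost_S i; have := cost_S j; have := gap0 i; have := costs0 Kstar j.
  by rewrite /gap; lra.
rewrite eval_step_size; split.
  have pos (x : R) : 0 <= x -> 0 < x + 1 by lra.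
  by rewrite !mulr_gt0 ?exprn_gt0 ?invr_gt0 ?pos ?ler0n // ltW.
move=> eps eta eps0 eta0 eta_lt M MP.
have etaP : eta * (gamma_R g + gamma_B g ^+ 2 * (Cmax / sX)) <= 2^-1.
  exact: (step_size_small N1 S0 (ltW C0) C_le gB0 gR0 sX0 eta0 eta_lt).
have step m i t : (t < horizon g)%N -> npg eta K0 m.+1 i t = npg eta K0 m i t -
    (2 * eta) *: natgrad (horizon g) (drift (npg eta K0 m) i) (gB g i) (gR g i) (gQ g i) (npg eta K0 m i) t.
  exact: npgE.
have bounded m i : gap i (npg eta K0 m) Kstar <= psi K0 Kstar.
  elim: m i => [|m IH] i; first exact: gap_psi.
  exact: (one_step_le_psi hQ hR h0 hW nash psi0 cost_C rsP rhoP rho0 eta0 etaP bP IH (@step m)).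
pose G m := \sum_i gap i (npg eta K0 m) Kstar.
have G0 m : 0 <= G m by apply: sumr_ge0 => i _; exact: gap_ge0.
have Gstep m : G m.+1 <= expR (- (alpha * eta)) * G m.
  have := one_step_sum hQ hR h0 hW nash psi0 cost_C rsP rhoP rho0 eta0 etaP bP
    (bounded m) (@step m).
  rewrite -/(G m.+1) -/(G m) -/Sn -/a -/b => H; apply: (le_trans H).
  apply: ler_wpM2r => //; apply: le_trans (expR_ge1Dx _).
  rewrite lerD2l lerN2; have ab : alpha <= 2 * (a - b * (N - 1) ^+ 2) by rewrite alphaE; lra.
  have := ler_wpM2l (ltW eta0) ab; lra.
have Gpow m : G m <= expR (- (alpha * eta) * m%:R) * G 0%N.
  elim: m => [|m IH]; first by rewrite mulr0 expR0 mul1r.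
  apply: (le_trans (Gstep m)).
  rewrite -natr1 mulrDr mulr1 expRD [X in _ <= X * _]mulrC -mulrA.
  by rewrite ler_wpM2l // expR_ge0.
apply: (le_trans (Gpow M)).
have := G0 0%N; rewrite le_eqVlt => /orP[/eqP <-|Gpos]; first by rewrite mulr0 ltW.
have ae : 0 < alpha * eta by exact: mulr_gt0.
have lnM : ln (G 0%N / eps) <= alpha * eta * M%:R.
  by move: MP; rewrite div1r mulrC ler_pdivrMr // (mulrC M%:R).
rewrite mulNr expRN -ler_pdivlMl ?invr_gt0 ?expR_gt0 // invrK.
rewrite -ler_pdivrMr // -[leLHS]lnK ?posrE ?divr_gt0 //.
by rewrite ler_expR.
Qed.
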